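(* Let $X$ be an irreducible semiring scheme which is locally isomorphic to $\operatorname{Spec} R$, where $R$ is a zero-sum free semiring with only trivial idempotent pairs (i.e. $X$ is covered by open subschemes of the form $\operatorname{Spec} R$ with $R$ such a semiring). Then any vector bundle of rank $n$ on $X$ is a coproduct (direct sum) of $n$ line bundles on $X$. Moreover, this decomposition is unique up to permuting summands (the line bundles being considered up to isomorphism).
   Context: A semiring is a set with two operations $+,\cdot$ satisfying the axioms of a commutative ring with $0$ and $1$ except for the existence of additive inverses. A semiring $R$ is zero-sum free if $a+b=0$ implies $a=b=0$ for all $a,b\in R$. An idempotent pair of $R$ is a pair $(e,f)$ of elements of $R$ with $ef=0$ and $e+f=1$; it is nontrivial if $e,f\notin\{0,1\}$, and trivial otherwise. Ideals, prime ideals, the prime spectrum $\operatorname{Spec} R$ with its Zariski topology and structure sheaf are defined for semirings exactly as for commutative rings. A semiring scheme is a topological space with a sheaf of semirings, whose stalks each have a unique maximal ideal, and which is locally isomorphic to affine semiring schemes $\operatorname{Spec} R$. Modules over a semiring are commutative monoids with an action satisfying the usual axioms; $\mathcal{O}_X$-modules are defined accordingly. A vector bundle on $X$ is an $\mathcal{O}_X$-module $\mathcal{F}$ such that each $x\in X$ has an open neighborhood $U$ and a finite set $I$ with $\mathcal{F}|_U\simeq\bigoplus_{i\in I}\mathcal{O}_X|_U$ as $\mathcal{O}_X|_U$-modules; it has rank $n$ if $|I|=n$ for each such $U$. A line bundle is a vector bundle of rank $1$. *)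

(* Defs.v *)
From HB Require Import structures.
From mathcomp Require Import all_boot all_order all_algebra all_fingroup.
From mathcomp Require Import generic_quotient.
From mathcomp Require Import ring.
From mathcomp Require Import all_classical topology.

Set Implicit Arguments.
Unset Strict Implicit.
Unset Printing Implicit Defensive.

Import GRing.Theory.
Local Open Scope classical_set_scope.
Local Open Scope ring_scope.
Local Open Scope quotient_scope.

(* "Semiring" is [comPzSemiRingType]: the semiring with [0 = 1] is allowed, as
   it has to be for sections over the empty set. *)

Section Semirings.
Variable R : comPzSemiRingType.

Definition zero_sum_free := forall a b : R, a + b = 0 -> a = 0 /\ b = 0.

Definition idempotent_pair (e f : R) := e * f = 0 /\ e + f = 1.

Definition nontrivial_pair (e f : R) :=
  [/\ e <> 0, e <> 1, f <> 0 & f <> 1].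

Definition only_trivial_idempotent_pairs :=
  forall e f : R, idempotent_pair e f -> ~ nontrivial_pair e f.

Definition is_ideal (I : set R) :=
  [/\ I 0, forall x y, I x -> I y -> I (x + y) & forall a x, I x -> I (a * x)].

Definition prime_ideal (I : set R) :=
  [/\ is_ideal I, I <> setT & forall x y, I (x * y) -> I x \/ I y].

Definition maximal_ideal (I : set R) :=
  [/\ is_ideal I, I <> setT &
      forall J, is_ideal J -> I `<=` J -> J = I \/ J = setT].

Definition local_semiring := exists! I : set R, maximal_ideal I.

End Semirings.

(* Operations satisfying the semiring axioms only up to the congruence [peqv];
   stalks and localizations are obtained as quotients of such data. *)
Record presemiring := PreSemiring {
  pcar :> choiceType;
  peqv : pcar -> pcar -> Prop;
  pzero : pcar;
  pone : pcar;
  padd : pcar -> pcar -> pcar;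
  pmul : pcar -> pcar -> pcar;
  peqv_refl : forall x, peqv x x;
  peqv_sym : forall x y, peqv x y -> peqv y x;
  peqv_trans : forall y x z, peqv x y -> peqv y z -> peqv x z;
  padd_eqv : forall x x' y y',
    peqv x x' -> peqv y y' -> peqv (padd x y) (padd x' y');
  pmul_eqv : forall x x' y y',
    peqv x x' -> peqv y y' -> peqv (pmul x y) (pmul x' y');
  paddA : forall x y z, peqv (padd x (padd y z)) (padd (padd x y) z);
  paddC : forall x y, peqv (padd x y) (padd y x);
  padd0 : forall x, peqv (padd pzero x) x;
  pmulA : forall x y z, peqv (pmul x (pmul y z)) (pmul (pmul x y) z);
  pmulC : forall x y, peqv (pmul x y) (pmul y x);
  pmul1 : forall x, peqv (pmul pone x) x;
  pmulD : forall x y z,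
    peqv (pmul (padd x y) z) (padd (pmul x z) (pmul y z));
  pmul0 : forall x, peqv (pmul pzero x) pzero }.

Section SemiringQuotient.
Variable S : presemiring.

Definition peqvb (x y : S) : bool := `[< peqv x y >].

Fact peqvb_equiv : equiv_class_of peqvb.
Proof.
split=> [x|x y|y x z]; first exact/asboolP/peqv_refl.
  by apply/asboolP/asboolP; exact: peqv_sym.
by move=> /asboolP xy /asboolP yz; apply/asboolP; exact: peqv_trans xy yz.
Qed.

Canonical peqv_equiv_rel := EquivRelPack peqvb_equiv.

Definition semiring_quot : Type := {eq_quot peqvb}.
HB.instance Definition _ := Choice.on semiring_quot.

Definition semiring_class (x : S) : semiring_quot := \pi_({eq_quot peqvb}) x.

Lemma semiring_classP x y : semiring_class x = semiring_class y <-> peqv x y.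
Proof. by split=> [/eqmodP/asboolP|xy] //; apply/eqmodP/asboolP. Qed.

Definition semiring_repr (x : semiring_quot) : S := repr x.

Lemma semiring_reprK x : semiring_class (semiring_repr x) = x.
Proof. exact: reprK. Qed.

Lemma peqv_repr x : peqv (semiring_repr (semiring_class x)) x.
Proof. by apply/semiring_classP; rewrite semiring_reprK. Qed.

Definition quot_add (x y : semiring_quot) :=
  semiring_class (padd (semiring_repr x) (semiring_repr y)).
Definition quot_mul (x y : semiring_quot) :=
  semiring_class (pmul (semiring_repr x) (semiring_repr y)).

Lemma quot_addE x y :
  quot_add (semiring_class x) (semiring_class y) = semiring_class (padd x y).
Proof. by apply/semiring_classP/padd_eqv; exact: peqv_repr. Qed.

Lemma quot_mulE x y :
  quot_mul (semiring_class x) (semiring_class y) = semiring_class (pmul x y).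
Proof. by apply/semiring_classP/pmul_eqv; exact: peqv_repr. Qed.

Lemma semiring_quotW (P : semiring_quot -> Prop) :
  (forall x, P (semiring_class x)) -> forall x, P x.
Proof. by move=> Pc x; rewrite -(semiring_reprK x). Qed.

Fact quot_addA : associative quot_add.
Proof.
elim/semiring_quotW=> x; elim/semiring_quotW=> y; elim/semiring_quotW=> z.
by rewrite !quot_addE; apply/semiring_classP/paddA.
Qed.

Fact quot_addC : commutative quot_add.
Proof.
elim/semiring_quotW=> x; elim/semiring_quotW=> y.
by rewrite !quot_addE; apply/semiring_classP/paddC.
Qed.

Fact quot_add0 : left_id (semiring_class (pzero S)) quot_add.
Proof.
by elim/semiring_quotW=> x; rewrite quot_addE; apply/semiring_classP/padd0.
Qed.

Fact quot_mulA : associative quot_mul.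
Proof.
elim/semiring_quotW=> x; elim/semiring_quotW=> y; elim/semiring_quotW=> z.
by rewrite !quot_mulE; apply/semiring_classP/pmulA.
Qed.

Fact quot_mulC : commutative quot_mul.
Proof.
elim/semiring_quotW=> x; elim/semiring_quotW=> y.
by rewrite !quot_mulE; apply/semiring_classP/pmulC.
Qed.

Fact quot_mul1 : left_id (semiring_class (pone S)) quot_mul.
Proof.
by elim/semiring_quotW=> x; rewrite quot_mulE; apply/semiring_classP/pmul1.
Qed.

Fact quot_mulD : left_distributive quot_mul quot_add.
Proof.
elim/semiring_quotW=> x; elim/semiring_quotW=> y; elim/semiring_quotW=> z.
by rewrite (quot_addE x) !quot_mulE quot_addE; apply/semiring_classP/pmulD.
Qed.

Fact quot_mul0 : left_zero (semiring_class (pzero S)) quot_mul.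
Proof.
by elim/semiring_quotW=> x; rewrite quot_mulE; apply/semiring_classP/pmul0.
Qed.

HB.instance Definition _ :=
  GRing.isNmodule.Build semiring_quot quot_addA quot_addC quot_add0.
HB.instance Definition _ := GRing.Nmodule_isComPzSemiRing.Build semiring_quot
  quot_mulA quot_mulC quot_mul1 quot_mulD quot_mul0.

End SemiringQuotient.

Section DependentProduct.
Variables (I : Type).

Definition dprod (T : I -> Type) : Type := forall i, T i.

HB.instance Definition _ (T : I -> Type) := gen_eqMixin (dprod T).
HB.instance Definition _ (T : I -> Type) := gen_choiceMixin (dprod T).

Section Nmod.
Variable T : I -> nmodType.
Implicit Types s t u : dprod T.

Definition dprod_zero : dprod T := fun=> 0.
Definition dprod_add s t : dprod T := fun i => s i + t i.

Fact dprod_addA : associative dprod_add.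
Proof. by move=> s t u; apply: functional_extensionality_dep => i; exact: addrA. Qed.
Fact dprod_addC : commutative dprod_add.
Proof. by move=> s t; apply: functional_extensionality_dep => i; exact: addrC. Qed.
Fact dprod_add0 : left_id dprod_zero dprod_add.
Proof. by move=> s; apply: functional_extensionality_dep => i; exact: add0r. Qed.

HB.instance Definition _ :=
  GRing.isNmodule.Build (dprod T) dprod_addA dprod_addC dprod_add0.
End Nmod.

Section SemiRing.
Variable T : I -> comPzSemiRingType.
Implicit Types s t u : dprod T.

Definition dprod_one : dprod T := fun=> 1.
Definition dprod_mul s t : dprod T := fun i => s i * t i.

Fact dprod_mulA : associative dprod_mul.
Proof. by move=> s t u; apply: functional_extensionality_dep => i; exact: mulrA. Qed.
Fact dprod_mulC : commutative dprod_mul.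
Proof. by move=> s t; apply: functional_extensionality_dep => i; exact: mulrC. Qed.
Fact dprod_mul1 : left_id dprod_one dprod_mul.
Proof. by move=> s; apply: functional_extensionality_dep => i; exact: mul1r. Qed.
Fact dprod_mulD : left_distributive dprod_mul +%R.
Proof. by move=> s t u; apply: functional_extensionality_dep => i; exact: mulrDl. Qed.
Fact dprod_mul0 : left_zero (0 : dprod T) dprod_mul.
Proof. by move=> s; apply: functional_extensionality_dep => i; exact: mul0r. Qed.

HB.instance Definition _ := GRing.Nmodule_isComPzSemiRing.Build (dprod T)
  dprod_mulA dprod_mulC dprod_mul1 dprod_mulD dprod_mul0.
End SemiRing.

Section Module.
Variables (R : pzSemiRingType) (T : I -> lSemiModType R).
Implicit Types s t : dprod T.

Definition dprod_scale (a : R) s : dprod T := fun i => a *: s i.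

Fact dprod_scaleA a b s :
  dprod_scale a (dprod_scale b s) = dprod_scale (a * b) s.
Proof. by apply: functional_extensionality_dep => i; exact: scalerA. Qed.
Fact dprod_scale0 s : dprod_scale 0 s = 0.
Proof. by apply: functional_extensionality_dep => i; exact: scale0r. Qed.
Fact dprod_scale1 : left_id 1 dprod_scale.
Proof. by move=> s; apply: functional_extensionality_dep => i; exact: scale1r. Qed.
Fact dprod_scaleDr : right_distributive dprod_scale +%R.
Proof. by move=> a s t; apply: functional_extensionality_dep => i; exact: scalerDr. Qed.
Fact dprod_scaleDl s : {morph dprod_scale^~ s : a b / a + b}.
Proof. by move=> a b; apply: functional_extensionality_dep => i; exact: scalerDl. Qed.

HB.instance Definition _ := GRing.Nmodule_isLSemiModule.Build R (dprod T)
  dprod_scaleA dprod_scale0 dprod_scale1 dprod_scaleDr dprod_scaleDl.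
End Module.
End DependentProduct.

Record opens (X : topologicalType) := Opens {
  open_set :> set X;
  openP : open open_set }.

Section Opens.
Variable X : topologicalType.
Implicit Types U V : opens X.

Definition opensT : opens X := Opens openT.
Definition opensI U V : opens X := Opens (openI (openP U) (openP V)).

Lemma opensIl U V : opensI U V `<=` U. Proof. exact: subIsetl. Qed.
Lemma opensIr U V : opensI U V `<=` V. Proof. exact: subIsetr. Qed.

Definition opens_incl U V (VU : V `<=` U) (p : set_type V) : set_type U :=
  Sub (val p) (mem_set (VU _ (set_valP p))).
End Opens.
Arguments opensT {X}.
Arguments opensIl {X U V}.
Arguments opensIr {X U V}.

Definition irreducible_space (X : topologicalType) :=
  [set: X] !=set0 /\
  forall A B : set X, closed A -> closed B -> A `|` B = setT ->
    A = setT \/ B = setT.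

Definition is_sheaf (X : topologicalType) (F : opens X -> Type)
    (res : forall U V : opens X, V `<=` U -> F U -> F V) :=
  forall (I : Type) (V : I -> opens X) (U : opens X)
         (VU : forall i, V i `<=` U), U `<=` \bigcup_i V i ->
  forall s : (forall i, F (V i)),
    (forall i j (W : opens X) (Wi : W `<=` V i) (Wj : W `<=` V j),
       res _ _ Wi (s i) = res _ _ Wj (s j)) ->
  exists! t : F U, forall i, res _ _ (VU i) t = s i.

Record semiringedSpace := SemiringedSpace {
  space :> topologicalType;
  osec : opens space -> comPzSemiRingType;
  ores : forall U V : opens space, V `<=` U -> {rmorphism osec U -> osec V};
  ores_id : forall (U : opens space) (UU : U `<=` U) (s : osec U),
    ores UU s = s;
  ores_comp : forall (U V W : opens space) (VU : V `<=` U) (WV : W `<=` V)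
      (WU : W `<=` U) (s : osec U), ores WU s = ores WV (ores VU s);
  ores_sheaf : is_sheaf (fun U V VU => ores VU) }.

Arguments osec {_} _.
Arguments ores {_ U V} _.

Section Stalk.
Variables (X : semiringedSpace) (x : X).

Record germ := Germ {
  germ_dom : opens X;
  germ_in : open_set germ_dom x;
  germ_sec : osec germ_dom }.

HB.instance Definition _ := gen_eqMixin germ.
HB.instance Definition _ := gen_choiceMixin germ.

Definition germ_eqv (s t : germ) :=
  exists (W : opens X) (Ws : W `<=` germ_dom s) (Wt : W `<=` germ_dom t),
    open_set W x /\ ores Ws (germ_sec s) = ores Wt (germ_sec t).


Definition germ_zero : germ := @Germ opensT Logic.I 0.
Definition germ_one : germ := @Germ opensT Logic.I 1.
Definition germ_add (s t : germ) : germ :=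
  @Germ (opensI (germ_dom s) (germ_dom t)) (conj (germ_in s) (germ_in t))
    (ores opensIl (germ_sec s) + ores opensIr (germ_sec t)).
Definition germ_mul (s t : germ) : germ :=
  @Germ (opensI (germ_dom s) (germ_dom t)) (conj (germ_in s) (germ_in t))
    (ores opensIl (germ_sec s) * ores opensIr (germ_sec t)).

Section OnCommonDomain.
Variable W : opens X.

Definition germ_at (s : germ) (c : osec W) :=
  exists Ws : W `<=` germ_dom s, ores Ws (germ_sec s) = c.

Lemma germ_at0 : germ_at germ_zero 0.
Proof. by exists (@subsetT _ W); rewrite rmorph0. Qed.

Lemma germ_at1 : germ_at germ_one 1.
Proof. by exists (@subsetT _ W); rewrite rmorph1. Qed.

Lemma germ_atD s t c d :
  germ_at s c -> germ_at t d -> germ_at (germ_add s t) (c + d).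
Proof.
move=> [Ws <-] [Wt <-].
have Wst : W `<=` opensI (germ_dom s) (germ_dom t).
  by move=> y Wy; split; [exact: Ws | exact: Wt].
by exists Wst; rewrite /= rmorphD -!ores_comp.
Qed.

Lemma germ_atM s t c d :
  germ_at s c -> germ_at t d -> germ_at (germ_mul s t) (c * d).
Proof.
move=> [Ws <-] [Wt <-].
have Wst : W `<=` opensI (germ_dom s) (germ_dom t).
  by move=> y Wy; split; [exact: Ws | exact: Wt].
by exists Wst; rewrite /= rmorphM -!ores_comp.
Qed.

Lemma germ_atP s (Ws : W `<=` germ_dom s) : germ_at s (ores Ws (germ_sec s)).
Proof. by exists Ws. Qed.

Lemma germ_at_eqv s t c : open_set W x -> germ_at s c -> germ_at t c -> germ_eqv s t.
Proof. by move=> Wx [Ws es] [Wt et]; exists W, Ws, Wt; rewrite es et. Qed.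

End OnCommonDomain.

Lemma germ_at_res (W Z : opens X) (ZW : Z `<=` W) s (c : osec W) :
  germ_at s c -> germ_at s (ores ZW c).
Proof.
case=> Ws <-; exists (subset_trans ZW Ws).
exact: ores_comp.
Qed.

Lemma germ_eqv_at s t :
  germ_eqv s t -> exists W, open_set W x /\
    exists2 c : osec W, germ_at s c & germ_at t c.
Proof.
case=> W [Ws [Wt [Wx e]]]; exists W; split=> //; exists (ores Ws (germ_sec s)).
  exact: germ_atP.
by exists Wt.
Qed.

Fact germ_eqv_refl s : germ_eqv s s.
Proof.
exact: germ_at_eqv (germ_in s) (germ_atP (@subset_refl _ _)) (germ_atP _).
Qed.

Fact germ_eqv_sym s t : germ_eqv s t -> germ_eqv t s.
Proof. by case=> W [Ws [Wt [Wx e]]]; exists W, Wt, Ws. Qed.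

Fact germ_eqv_trans t s u : germ_eqv s t -> germ_eqv t u -> germ_eqv s u.
Proof.
move=> /germ_eqv_at[W [Wx [c sc [Wt tc]]]] /germ_eqv_at[Z [Zx [d [Zt td] ud]]].
apply: (@germ_at_eqv (opensI W Z) _ _ (ores opensIl c)); first by [].
  exact: germ_at_res.
suff -> : ores (@opensIl _ W Z) c = ores (@opensIr _ W Z) d by exact: germ_at_res.
by rewrite -tc -td -!(ores_comp _ _ (subset_trans (@opensIl _ W Z) Wt)).
Qed.

Lemma germ_eqv_common s s' t t' : germ_eqv s s' -> germ_eqv t t' ->
  exists W, open_set W x /\ exists c d : osec W,
    [/\ germ_at s c, germ_at s' c, germ_at t d & germ_at t' d].
Proof.
move=> /germ_eqv_at[W [Wx [c sc s'c]]] /germ_eqv_at[Z [Zx [d td t'd]]].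
exists (opensI W Z); split; first by split.
exists (ores (@opensIl _ W Z) c), (ores (@opensIr _ W Z) d).
by split; exact: germ_at_res.
Qed.

Fact germ_add_eqv s s' t t' : germ_eqv s s' -> germ_eqv t t' ->
  germ_eqv (germ_add s t) (germ_add s' t').
Proof.
move=> /germ_eqv_common es /es[W [Wx [c [d [sc s'c td t'd]]]]].
exact: germ_at_eqv Wx (germ_atD sc td) (germ_atD s'c t'd).
Qed.

Fact germ_mul_eqv s s' t t' : germ_eqv s s' -> germ_eqv t t' ->
  germ_eqv (germ_mul s t) (germ_mul s' t').
Proof.
move=> /germ_eqv_common es /es[W [Wx [c [d [sc s'c td t'd]]]]].
exact: germ_at_eqv Wx (germ_atM sc td) (germ_atM s'c t'd).
Qed.

Lemma germ_eqv3 (P Q : germ -> germ -> germ -> germ) :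
  (forall W s t u (a b c : osec W), germ_at s a -> germ_at t b -> germ_at u c ->
     exists2 d : osec W, germ_at (P s t u) d & germ_at (Q s t u) d) ->
  forall s t u, germ_eqv (P s t u) (Q s t u).
Proof.
move=> PQ s t u.
pose W := opensI (germ_dom s) (opensI (germ_dom t) (germ_dom u)).
have Ws : W `<=` germ_dom s by move=> y [].
have Wt : W `<=` germ_dom t by move=> y [_ []].
have Wu : W `<=` germ_dom u by move=> y [_ []].
have [d dP dQ] := PQ W s t u _ _ _ (germ_atP Ws) (germ_atP Wt) (germ_atP Wu).
apply: germ_at_eqv dP dQ.
by split; [exact: germ_in | split; exact: germ_in].
Qed.

Fact germ_addA s t u :
  germ_eqv (germ_add s (germ_add t u)) (germ_add (germ_add s t) u).
Proof.
move: s t u; apply: germ_eqv3 => W s t u a b c sa tb uc.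
exists (a + (b + c)); first by do 2!apply: germ_atD => //.
by rewrite addrA; do 2!apply: germ_atD => //.
Qed.

Fact germ_addC s t : germ_eqv (germ_add s t) (germ_add t s).
Proof.
apply: (@germ_eqv3 (fun s t _ => germ_add s t) (fun s t _ => germ_add t s) _
  s t t) => W {}s {}t _ a b _ sa tb _.
by exists (a + b); [|rewrite addrC]; exact: germ_atD.
Qed.

Fact germ_add0 s : germ_eqv (germ_add germ_zero s) s.
Proof.
apply: (@germ_eqv3 (fun s _ _ => germ_add germ_zero s) (fun s _ _ => s) _
  s s s) => W {}s _ _ a _ _ sa _ _.
by exists a => //; rewrite -[a]add0r; apply: germ_atD => //; exact: germ_at0.
Qed.

Fact germ_mulA s t u :
  germ_eqv (germ_mul s (germ_mul t u)) (germ_mul (germ_mul s t) u).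
Proof.
move: s t u; apply: germ_eqv3 => W s t u a b c sa tb uc.
exists (a * (b * c)); first by do 2!apply: germ_atM => //.
by rewrite mulrA; do 2!apply: germ_atM => //.
Qed.

Fact germ_mulC s t : germ_eqv (germ_mul s t) (germ_mul t s).
Proof.
apply: (@germ_eqv3 (fun s t _ => germ_mul s t) (fun s t _ => germ_mul t s) _
  s t t) => W {}s {}t _ a b _ sa tb _.
by exists (a * b); [|rewrite mulrC]; exact: germ_atM.
Qed.

Fact germ_mul1 s : germ_eqv (germ_mul germ_one s) s.
Proof.
apply: (@germ_eqv3 (fun s _ _ => germ_mul germ_one s) (fun s _ _ => s) _
  s s s) => W {}s _ _ a _ _ sa _ _.
by exists a => //; rewrite -[a]mul1r; apply: germ_atM => //; exact: germ_at1.
Qed.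

Fact germ_mulD s t u : germ_eqv (germ_mul (germ_add s t) u)
  (germ_add (germ_mul s u) (germ_mul t u)).
Proof.
move: s t u; apply: germ_eqv3 => W s t u a b c sa tb uc.
exists ((a + b) * c); first by apply: germ_atM => //; exact: germ_atD.
by rewrite mulrDl; apply: germ_atD; exact: germ_atM.
Qed.

Fact germ_mul0 s : germ_eqv (germ_mul germ_zero s) germ_zero.
Proof.
apply: (@germ_eqv3 (fun s _ _ => germ_mul germ_zero s) (fun _ _ _ => germ_zero)
  _ s s s) => W {}s _ _ a _ _ sa _ _.
exists 0; last exact: germ_at0.
by rewrite -(mul0r a); apply: germ_atM => //; exact: germ_at0.
Qed.

Definition pre_stalk : presemiring := PreSemiring
  germ_eqv_refl germ_eqv_sym germ_eqv_trans germ_add_eqv germ_mul_eqv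
  germ_addA germ_addC germ_add0 germ_mulA germ_mulC germ_mul1 germ_mulD
  germ_mul0.

Definition stalk : comPzSemiRingType := semiring_quot pre_stalk.

End Stalk.

Section Spectrum.
Variable R : comPzSemiRingType.

Record spec := Spec {
  spec_set :> set R;
  spec_prime : prime_ideal spec_set }.

HB.instance Definition _ := gen_eqMixin spec.
HB.instance Definition _ := gen_choiceMixin spec.

Definition vanishing (E : set R) : set spec := [set p | E `<=` p].

Definition zariski_open (U : set spec) := exists E, U = ~` vanishing E.

Fact zariski_openT : zariski_open setT.
Proof.
exists setT; apply/seteqP; split=> // p _ /= pT.
by case: (spec_prime p) => _ + _; apply; apply/seteqP; split.
Qed.

Fact zariski_openI : setI_closed zariski_open.
Proof.
move=> _ _ [E ->] [F ->]; exists [set x | exists2 a, E a & exists2 b, F b & x = a * b].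
apply/seteqP; split=> p /=.
  move=> [/existsNP[a /not_implyP[Ea pa]] /existsNP[b /not_implyP[Fb pb]]].
  move=> /(_ (a * b)) pab; have [_ _ pr] := spec_prime p.
  by have [] : spec_set p a \/ spec_set p b by apply/pr/pab; exists a => //; exists b.
have [[_ _ pM] _ _] := spec_prime p.
move=> np; split=> pE; apply: np => _ [a Ea [b Fb ->]]; last exact/pM/pE.
by rewrite mulrC; exact/pM/pE.
Qed.

Fact zariski_open_bigU (I : Type) (f : I -> set spec) :
  (forall i, zariski_open (f i)) -> zariski_open (\bigcup_i f i).
Proof.
move=> /choice[E fE]; exists (\bigcup_i E i); apply/seteqP; split=> p.
  by move=> [i _]; rewrite fE => np pE; apply: np => x Ex; apply: pE; exists i.
move=> /existsNP[x /not_implyP[[i _ Ex] px]]; exists i => //.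
by rewrite fE => /(_ x Ex).
Qed.

HB.instance Definition _ :=
  isOpenTopological.Build spec zariski_openT zariski_openI zariski_open_bigU.

Section Localization.
Variable p : spec.

Lemma notin_prime1 : 1 \in ~` p.
Proof.
apply/mem_set => p1; have [[_ _ pM] + _] := spec_prime p; apply.
by apply/seteqP; split=> // x _; rewrite -(mulr1 x); exact: pM.
Qed.

Lemma notin_primeM a b : a \in ~` p -> b \in ~` p -> a * b \in ~` p.
Proof.
move=> /set_mem pa /set_mem pb; apply/mem_set => pab.
by have [_ _ pr] := spec_prime p; case: (pr _ _ pab).
Qed.

(* [(a, s)] stands for [a / s]. *)
Definition fraction := (R * set_type (~` p))%type.
Implicit Types x y z : fraction.

Definition den1 : set_type (~` p) := Sub 1 notin_prime1.
Definition denM (s t : set_type (~` p)) : set_type (~` p) :=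
  Sub (val s * val t) (notin_primeM (valP s) (valP t)).

Definition frac_eqv x y :=
  exists u : set_type (~` p), val u * (val y.2 * x.1) = val u * (val x.2 * y.1).
Definition frac_zero : fraction := (0, den1).
Definition frac_one : fraction := (1, den1).
Definition frac_add x y : fraction :=
  (val y.2 * x.1 + val x.2 * y.1, denM x.2 y.2).
Definition frac_mul x y : fraction := (x.1 * y.1, denM x.2 y.2).


Fact frac_eqv_refl x : frac_eqv x x.
Proof. by exists den1. Qed.

Fact frac_eqv_sym x y : frac_eqv x y -> frac_eqv y x.
Proof. by case=> u e; exists u. Qed.

Fact frac_eqv_trans y x z : frac_eqv x y -> frac_eqv y z -> frac_eqv x z.
Proof.
case: x y z => [a [s ?]] [b [t tp]] [c [r ?]] [u e] [v f].
exists (denM (denM u v) (exist _ t tp)).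
case: u v e f => [u ?] [v ?] /= e f.
transitivity (v * r * (u * (t * a))); first by ring.
rewrite e; transitivity (u * s * (v * (r * b))); first by ring.
by rewrite f; ring.
Qed.

Fact frac_add_eqv x x' y y' : frac_eqv x x' -> frac_eqv y y' ->
  frac_eqv (frac_add x y) (frac_add x' y').
Proof.
case: x x' y y' => [a [s ?]] [a' [s' ?]] [b [t ?]] [b' [t' ?]] [u e] [v f].
exists (denM u v); case: u v e f => [u ?] [v ?] /= e f.
transitivity (v * t * t' * (u * (s' * a)) + u * s * s' * (v * (t' * b))).
  by ring.
by rewrite e f; ring.
Qed.

Fact frac_mul_eqv x x' y y' : frac_eqv x x' -> frac_eqv y y' ->
  frac_eqv (frac_mul x y) (frac_mul x' y').
Proof.
case: x x' y y' => [a [s ?]] [a' [s' ?]] [b [t ?]] [b' [t' ?]] [u e] [v f].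
exists (denM u v); case: u v e f => [u ?] [v ?] /= e f.
transitivity (u * (s' * a) * (v * (t' * b))); first by ring.
by rewrite e f; ring.
Qed.

Fact frac_addA x y z :
  frac_eqv (frac_add x (frac_add y z)) (frac_add (frac_add x y) z).
Proof.
by case: x y z => [a [s ?]] [b [t ?]] [c [r ?]]; exists den1 => /=; ring.
Qed.

Fact frac_addC x y : frac_eqv (frac_add x y) (frac_add y x).
Proof. by case: x y => [a [s ?]] [b [t ?]]; exists den1 => /=; ring. Qed.

Fact frac_add0 x : frac_eqv (frac_add frac_zero x) x.
Proof. by case: x => [a [s ?]]; exists den1 => /=; ring. Qed.

Fact frac_mulA x y z :
  frac_eqv (frac_mul x (frac_mul y z)) (frac_mul (frac_mul x y) z).
Proof.
by case: x y z => [a [s ?]] [b [t ?]] [c [r ?]]; exists den1 => /=; ring.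
Qed.

Fact frac_mulC x y : frac_eqv (frac_mul x y) (frac_mul y x).
Proof. by case: x y => [a [s ?]] [b [t ?]]; exists den1 => /=; ring. Qed.

Fact frac_mul1 x : frac_eqv (frac_mul frac_one x) x.
Proof. by case: x => [a [s ?]]; exists den1 => /=; ring. Qed.

Fact frac_mulD x y z : frac_eqv (frac_mul (frac_add x y) z)
  (frac_add (frac_mul x z) (frac_mul y z)).
Proof.
by case: x y z => [a [s ?]] [b [t ?]] [c [r ?]]; exists den1 => /=; ring.
Qed.

Fact frac_mul0 x : frac_eqv (frac_mul frac_zero x) frac_zero.
Proof. by case: x => [a [s ?]]; exists den1 => /=; ring. Qed.

Definition pre_localization : presemiring := PreSemiring
  frac_eqv_refl frac_eqv_sym frac_eqv_trans frac_add_eqv frac_mul_eqv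
  frac_addA frac_addC frac_add0 frac_mulA frac_mulC frac_mul1 frac_mulD
  frac_mul0.

Definition localization : comPzSemiRingType := semiring_quot pre_localization.

Definition frac (a : R) (s : set_type (~` p)) : localization :=
  semiring_class ((a, s) : pre_localization).

End Localization.

End Spectrum.

Section StructureSheaf.
Variable R : comPzSemiRingType.

Definition stalkwise (U : opens (spec R)) :=
  dprod (fun p : set_type U => localization (val p)).
HB.instance Definition _ U := GRing.ComPzSemiRing.on (stalkwise U).

(* Near each point of [U], [s] is given by one fraction [a / f]. *)
Definition locally_fraction (U : opens (spec R)) (s : stalkwise U) :=
  forall p : set_type U, exists V : opens (spec R),
    [/\ V `<=` U, open_set V (val p) & exists a f : R,
      forall q : set_type U, open_set V (val q) ->
        exists qf : f \in ~` val q, s q = frac a (Sub f qf)].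

Definition regular_section U : {pred stalkwise U} :=
  fun s => `[< locally_fraction s >].

Lemma fracD (p : spec R) a b s t :
  frac a s + frac b t = frac (val t * a + val s * b) (denM s t) :> localization p.
Proof. exact: quot_addE. Qed.

Lemma fracM (p : spec R) a b s t :
  frac a s * frac b t = frac (a * b) (denM s t) :> localization p.
Proof. exact: quot_mulE. Qed.

Lemma locally_fraction_cst U (c : R) (s : stalkwise U) :
  (forall p, s p = frac c (den1 (val p))) -> locally_fraction s.
Proof.
move=> sc p; exists U; split=> //; first exact: set_valP.
by exists c, 1 => q _; exists (notin_prime1 (val q)); rewrite sc.
Qed.

Lemma locally_fraction_op U (s t st : stalkwise U) (op : R -> R -> R -> R -> R) :
  (forall p a f b g, s p = frac a f -> t p = frac b g ->
    st p = frac (op a (val f) b (val g)) (denM f g)) ->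
  locally_fraction s -> locally_fraction t -> locally_fraction st.
Proof.
move=> opE sf tf p.
have [V [VU Vp [a [f sE]]]] := sf p; have [W [WU Wp [b [g tE]]]] := tf p.
exists (opensI V W); split; [by move=> q [/VU] | by split |].
exists (op a f b g), (f * g) => q [/sE[qf sq] /tE[qg tq]].
exists (notin_primeM qf qg); rewrite (opE _ _ _ _ _ sq tq).
by congr frac; exact: val_inj.
Qed.

Fact regular_section_closed U : semiring_closed (@regular_section U).
Proof.
split; split.
- by apply/asboolP; apply: (@locally_fraction_cst U 0) => p.
- move=> s t /asboolP sf /asboolP tf; apply/asboolP.
  apply: (@locally_fraction_op _ s t _ (fun a f b g => g * a + f * b)) sf tf.
  by move=> p a f b g es et; rewrite -fracD -es -et.
- by apply/asboolP; apply: (@locally_fraction_cst U 1) => p.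
- move=> s t /asboolP sf /asboolP tf; apply/asboolP.
  apply: (@locally_fraction_op _ s t _ (fun a f b g => a * b)) sf tf.
  by move=> p a f b g es et; rewrite -fracM -es -et.
Qed.

Record spec_sec (U : opens (spec R)) := SpecSec {
  spec_secval :> stalkwise U;
  _ : spec_secval \in @regular_section U }.

HB.instance Definition _ U := [isSub for @spec_secval U].
HB.instance Definition _ U := [Choice of spec_sec U by <:].
HB.instance Definition _ U := GRing.SubChoice_isSubComPzSemiRing.Build
  (stalkwise U) (@regular_section U) (spec_sec U) (@regular_section_closed U).

Lemma spec_secP U (s : spec_sec U) : locally_fraction s.
Proof. exact/asboolP/(valP s). Qed.

Lemma spec_secE U (s t : spec_sec U) :
  (forall p, spec_secval s p = spec_secval t p) -> s = t.
Proof. by move=> st; apply/val_inj/functional_extensionality_dep. Qed.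

Section Restriction.
Variables (U V : opens (spec R)) (VU : V `<=` U).

Fact spec_res_subproof (s : spec_sec U) :
  ((fun p => spec_secval s (opens_incl VU p)) : stalkwise V) \in @regular_section V.
Proof.
apply/asboolP => p; have [W [WU Wp [a [f sE]]]] := spec_secP s (opens_incl VU p).
exists (opensI V W); split; [exact: opensIl | by split; [exact: set_valP|]|].
by exists a, f => q [_ Wq]; have [qf ->] := sE (opens_incl VU q) Wq; exists qf.
Qed.

Definition spec_res (s : spec_sec U) : spec_sec V :=
  SpecSec (spec_res_subproof s).

Fact spec_res_nmod : nmod_morphism spec_res.
Proof. by split=> [|s t]; exact: spec_secE. Qed.
Fact spec_res_monoid : monoid_morphism spec_res.
Proof. by split=> [|s t]; exact: spec_secE. Qed.

HB.instance Definition _ := GRing.isNmodMorphism.Build _ _ spec_res spec_res_nmod.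
HB.instance Definition _ :=
  GRing.isMonoidMorphism.Build _ _ spec_res spec_res_monoid.
End Restriction.

Lemma stalkwise_irr U (s : stalkwise U) (p : spec R) (h h' : p \in open_set U) :
  s (exist _ p h) = s (exist _ p h').
Proof. by rewrite (bool_irrelevance h h'). Qed.

Fact spec_sheaf : is_sheaf (fun U V (VU : V `<=` U) => @spec_res U V VU).
Proof.
move=> I V U VU Ucov s agree.
have cov (p : set_type U) : exists i, open_set (V i) (val p).
  by have [i _ Vip] := Ucov _ (set_valP p); exists i.
have [c cP] := choice cov.
pose t : stalkwise U := fun p => spec_secval (s (c p)) (Sub (val p) (mem_set (cP p))).
have tE i (q : set_type (V i)) : t (opens_incl (VU i) q) = spec_secval (s i) q.
  set p := opens_incl (VU i) q; pose W := opensI (V (c p)) (V i).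
  have Wq : val q \in open_set W.
    by apply: mem_set; split; [exact: (cP p) | exact: set_valP].
  have /(congr1 (fun r : spec_sec W => spec_secval r (Sub (val q) Wq))) :=
    agree _ _ W opensIl opensIr.
  rewrite /t; case: q @p @W Wq => [y Viy] p W Wq /= e.
  rewrite /opens_incl /= (stalkwise_irr _ _ Viy) in e.
  by rewrite -e; exact: stalkwise_irr.
have tf : t \in @regular_section U.
  apply/asboolP => p.
  have [W [WV Wp [a [f sE]]]] := spec_secP (s (c p)) (Sub (val p) (mem_set (cP p))).
  exists W; split=> //; first exact: subset_trans WV (VU _).
  exists a, f => q Wq.
  have [qf e] := sE (Sub (val q) (mem_set (WV _ Wq))) Wq.
  exists qf; rewrite -e -(tE (c p)).
  by case: q Wq qf e => [y Uy] Wq qf e /=; exact: stalkwise_irr.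
exists (SpecSec tf); split=> [i|t' t'E]; first by apply: spec_secE => q; exact: tE.
apply: spec_secE => p.
rewrite /= /t -(t'E (c p)) /=.
by case: p => y Uy; cbn -[localization]; exact: stalkwise_irr.
Qed.

Fact spec_res_id (U : opens (spec R)) (UU : U `<=` U) (s : spec_sec U) :
  spec_res UU s = s.
Proof. by apply: spec_secE => -[y Uy]; cbn -[localization]; exact: stalkwise_irr. Qed.

Fact spec_res_comp (U V W : opens (spec R)) (VU : V `<=` U) (WV : W `<=` V)
  (WU : W `<=` U) (s : spec_sec U) : spec_res WU s = spec_res WV (spec_res VU s).
Proof. by apply: spec_secE => -[y Wy]; cbn -[localization]; exact: stalkwise_irr. Qed.

Definition affine_scheme : semiringedSpace :=
  SemiringedSpace (ores := fun U V VU => spec_res VU)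
    spec_res_id spec_res_comp spec_sheaf.

End StructureSheaf.

Section OpenSubspace.
Variables (X : topologicalType) (U : opens X).

Fact sub_image_open (W : opens (set_type U)) :
  open ((val : set_type U -> X) @` W).
Proof.
case: W => _ /= [A oA <-].
rewrite (_ : _ @` _ = A `&` U); first exact: openI oA (openP U).
apply/seteqP; split=> [_ [y Ay <-]|y [Ay Uy]].
  by split=> //; exact: set_valP.
by exists (Sub y (mem_set Uy)).
Qed.

Definition sub_image (W : opens (set_type U)) : opens X :=
  Opens (sub_image_open W).

Lemma sub_imageS (V W : opens (set_type U)) :
  W `<=` V -> sub_image W `<=` sub_image V.
Proof. exact: image_subset. Qed.

Lemma sheaf_sub (F : opens X -> Type)
    (res : forall V W : opens X, W `<=` V -> F V -> F W) :
  (forall (V W Z : opens X) (WV : W `<=` V) (ZW : Z `<=` W) (ZV : Z `<=` V) s,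
     res _ _ ZV s = res _ _ ZW (res _ _ WV s)) ->
  is_sheaf res ->
  is_sheaf (fun (V W : opens (set_type U)) (WV : W `<=` V) =>
    res _ _ (sub_imageS WV)).
Proof.
move=> resc Fsh I V W VW Wcov s agree.
have cov : sub_image W `<=` \bigcup_i sub_image (V i).
  by move=> _ [y /Wcov[i _ Viy] <-]; exists i => //; exists y.
apply: (Fsh I (fun i => sub_image (V i)) (sub_image W)
          (fun i => sub_imageS (VW i)) cov s).
move=> i j Z Zi Zj.
have oZ : open ((val : set_type U -> X) @^-1` Z) by exists Z => //; exact: openP.
pose Z' := Opens oZ.
have Z'S k : Z `<=` sub_image (V k) -> Z' `<=` V k.
  by move=> ZV y /ZV[z Vz /val_inj <-].
have ZZ' : Z `<=` sub_image Z'.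
  by move=> y Zy; have [z _ zy] := Zi y Zy; exists z => //=; rewrite zy.
have := congr1 (res _ _ ZZ') (agree i j Z' (Z'S i Zi) (Z'S j Zj)).
by rewrite -!(resc _ _ _ _ _ Zi) -!(resc _ _ _ _ _ Zj).
Qed.
End OpenSubspace.

Section OpenSubscheme.
Variables (X : semiringedSpace) (U : opens X).

Fact sub_ores_id (V : opens (set_type U)) (VV : V `<=` V)
  (s : osec (sub_image V)) : ores (sub_imageS VV) s = s.
Proof. exact: ores_id. Qed.

(* Opens of [U] are identified with their images in [X]. *)
Definition open_sub : semiringedSpace :=
  @SemiringedSpace (set_type U) (fun V => osec (sub_image V))
    (fun V W WV => ores (sub_imageS WV)) sub_ores_id
    (fun _ _ _ _ _ _ => ores_comp _ _ _)
    (sheaf_sub (@ores_comp X) (@ores_sheaf X)).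
End OpenSubscheme.

Section Isomorphism.
Variables X Y : topologicalType.

Definition preim_opens (f : X -> Y) (cf : continuous f) (V : opens Y) :
    opens X :=
  Opens (open_comp (fun x _ => cf x) (openP V)).

Lemma preim_opensS (f : X -> Y) (cf : continuous f) (U V : opens Y) :
  V `<=` U -> preim_opens cf V `<=` preim_opens cf U.
Proof. exact: preimage_subset. Qed.
End Isomorphism.

(* An isomorphism of semiringed spaces automatically induces local maps on
   stalks, so no locality condition is needed. *)
Definition isomorphic_spaces (X Y : semiringedSpace) : Prop :=
  exists (f : X -> Y) (g : Y -> X) (cf : continuous f),
    [/\ continuous g, cancel f g, cancel g f &
    exists phi : forall V : opens Y,
        {rmorphism osec V -> osec (preim_opens cf V)},
      (forall V, bijective (phi V)) /\
      forall (U V : opens Y) (VU : V `<=` U) (s : osec U),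
        phi V (ores VU s) = ores (preim_opensS VU) (phi U s)].

Definition locally_spec (P : comPzSemiRingType -> Prop) (X : semiringedSpace) :=
  forall x : X, exists U : opens X, open_set U x /\
    exists R : comPzSemiRingType,
      P R /\ isomorphic_spaces (open_sub U) (affine_scheme R).

Definition semiring_scheme (X : semiringedSpace) :=
  (forall x : X, local_semiring (stalk x)) /\ locally_spec (fun=> True) X.

Record omodule (X : semiringedSpace) := OModule {
  msec : forall U : opens X, lSemiModType (osec U);
  mres : forall (U V : opens X) (VU : V `<=` U),
    {linear msec U -> msec V | ores VU \; *:%R};
  mres_id : forall (U : opens X) (UU : U `<=` U) (s : msec U), mres UU s = s;
  mres_comp : forall (U V W : opens X) (VU : V `<=` U) (WV : W `<=` V)
      (WU : W `<=` U) (s : msec U), mres WU s = mres WV (mres VU s);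
  mres_sheaf : is_sheaf (fun U V VU => mres VU) }.

Arguments msec {_} _ _.
Arguments mres {_} _ {_ _} _.

Definition omodule_iso (X : semiringedSpace) (F G : omodule X) : Prop :=
  exists phi : forall U : opens X, {linear msec F U -> msec G U},
    (forall U, bijective (phi U)) /\
    forall (U V : opens X) (VU : V `<=` U) (s : msec F U),
      phi V (mres F VU s) = mres G VU (phi U s).

Section UnitModule.
Variable X : semiringedSpace.

Section Restriction.
Variables (U V : opens X) (VU : V `<=` U).
Definition unit_res (s : (osec U)^o) : (osec V)^o := ores VU s.
Fact unit_res_semilinear : semilinear_for (ores VU \; *:%R) unit_res.
Proof. by split=> [a s|s t]; [exact: rmorphM | exact: rmorphD]. Qed.
HB.instance Definition _ :=
  GRing.isSemilinear.Build _ _ _ (ores VU \; *:%R) unit_res unit_res_semilinear.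
End Restriction.

Definition unit_omodule : omodule X :=
  @OModule X (fun U => (osec U)^o) (fun U V VU => unit_res VU)
    (@ores_id X) (@ores_comp X) (@ores_sheaf X).
End UnitModule.

Definition omodule_sub (X : semiringedSpace) (F : omodule X) (U : opens X) :
  omodule (open_sub U) :=
  @OModule (open_sub U) (fun V => msec F (sub_image V))
    (fun V W WV => mres F (sub_imageS WV))
    (fun _ _ _ => mres_id _ _)
    (fun _ _ _ _ _ _ => mres_comp _ _ _)
    (sheaf_sub (@mres_comp X F) (@mres_sheaf X F)).

Section DirectSum.
Variables (X : semiringedSpace) (I : finType) (L : I -> omodule X).

(* As [I] is finite, the sectionwise direct sum is the sectionwise product, and
   it is already a sheaf. *)
Definition dsum_sec (U : opens X) : lSemiModType (osec U) :=
  dprod (fun i => msec (L i) U).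

Section Restriction.
Variables (U V : opens X) (VU : V `<=` U).
Definition dsum_res (s : dsum_sec U) : dsum_sec V :=
  fun i => mres (L i) VU (s i).
Fact dsum_res_semilinear : semilinear_for (ores VU \; *:%R) dsum_res.
Proof.
split=> [a s|s t]; apply/functional_extensionality_dep => i.
  exact: linearZ.
exact: linearD.
Qed.
HB.instance Definition _ :=
  GRing.isSemilinear.Build _ _ _ (ores VU \; *:%R) dsum_res dsum_res_semilinear.
End Restriction.

Fact dsum_res_id (U : opens X) (UU : U `<=` U) (s : dsum_sec U) :
  dsum_res UU s = s.
Proof. by apply/functional_extensionality_dep => i; exact: mres_id. Qed.

Fact dsum_res_comp (U V W : opens X) (VU : V `<=` U) (WV : W `<=` V)
  (WU : W `<=` U) (s : dsum_sec U) : dsum_res WU s = dsum_res WV (dsum_res VU s).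
Proof. by apply/functional_extensionality_dep => i; exact: mres_comp. Qed.

Fact dsum_sheaf : is_sheaf (fun U V (VU : V `<=` U) => dsum_res VU).
Proof.
move=> J V U VU Ucov s agree.
have agreei i j k (W : opens X) (Wj : W `<=` V j) (Wk : W `<=` V k) :
    mres (L i) Wj (s j i) = mres (L i) Wk (s k i).
  exact: (congr1 (fun r : dsum_sec W => r i) (agree j k W Wj Wk)).
have glue i := mres_sheaf VU Ucov (agreei i).
pose t : dsum_sec U := fun i => sval (cid (glue i)).
exists t; split=> [j|t' t'E]; apply/functional_extensionality_dep => i.
  by have [+ _] := svalP (cid (glue i)); apply.
have [_] := svalP (cid (glue i)); apply=> j.
by rewrite -t'E.
Qed.

Definition dsum : omodule X :=
  @OModule X dsum_sec (fun U V VU => dsum_res VU)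
    dsum_res_id dsum_res_comp dsum_sheaf.
End DirectSum.

Section VectorBundles.
Variables (X : semiringedSpace) (F : omodule X).

Definition trivial_on (U : opens X) (I : finType) :=
  omodule_iso (omodule_sub F U) (dsum (fun _ : I => unit_omodule (open_sub U))).

Definition vector_bundle :=
  forall x : X, exists (U : opens X) (I : finType),
    open_set U x /\ trivial_on U I.

(* All trivializations around a point must have [n] summands; [U] is required to
   contain a point because over the empty set all modules are trivial. *)
Definition vector_bundle_of_rank (n : nat) :=
  vector_bundle /\
  forall (x : X) (U : opens X) (I : finType),
    open_set U x -> trivial_on U I -> #|I| = n.

Definition line_bundle := vector_bundle_of_rank 1.
End VectorBundles.

(* Main.v *)
From HB Require Import structures.
Require Import Defs.
From mathcomp Require Import all_boot ssralg all_fingroup.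
From mathcomp Require Import all_classical topology.

Set Implicit Arguments.
Unset Strict Implicit.
Unset Printing Implicit Defensive.

Import GRing.Theory.
Local Open Scope classical_set_scope.
Local Open Scope ring_scope.

(* On a nonempty open [U] of [X] the semiring [osec U] is nontrivial, zero-sum
   free, and has no idempotent pair besides (0, 1) and (1, 0): a pair (e, f) is
   (0, 1) or (1, 0) in each local semiring, so [U] is the disjoint union of the
   opens where e = 0 and where f = 0, and two nonempty opens of an irreducible
   space meet.  Over such a semiring every invertible matrix is monomial: if
   AB = BA = 1 then zero-sum freeness makes the products [A i j * B j i], for
   fixed i, orthogonal with sum 1, so exactly one of them is 1 and the others
   vanish.  Hence two frames of a vector bundle differ by a permutation and
   units, and the lines spanned by a frame over one fixed nonempty open [U0] can
   be followed over all of [X], since every nonempty open meets [U0].  These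
   lines are the summands.  An isomorphism between two sums of line bundles is
   likewise monomial in local generators, with a permutation that is locally
   constant, hence constant. *)

(** * Invertible matrices over semirings *)

Section Monomial.
Variable R : comPzSemiRingType.

(** As [e + f = 1], the last clause leaves only the pairs (0, 1) and (1, 0), which [1 <> 0] keeps
    distinct: an algebraic form of connectedness. *)
Definition connected_zero_sum_free :=
  [/\ 1 <> 0 :> R, zero_sum_free R &
      forall e f : R, idempotent_pair e f -> e = 0 \/ f = 0].

Hypothesis goodR : connected_zero_sum_free.

Lemma zsf_sum_eq0 (I : finType) (P : pred I) (E : I -> R) :
  \sum_(i | P i) E i = 0 -> forall i, P i -> E i = 0.
Proof.
move=> + i Pi; rewrite (bigD1 i) //=.
by have [_ zsf _] := goodR => /zsf[].
Qed.

(** An off-diagonal entry of [BA] is a zero sum, so each of its terms vanishes. A nonzero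
    [A i j * B j i] and the rest of its row sum therefore form an idempotent pair. *)
Lemma invertible_row (I J : finType) (A : I -> J -> R) (B : J -> I -> R) :
  (forall i k, \sum_j A i j * B j k = (i == k)%:R) ->
  (forall j l, \sum_i B j i * A i l = (j == l)%:R) ->
  forall i, exists j, A i j * B j i = 1 /\ forall k, k != j -> A i k = 0.
Proof.
move=> AB BA i; have [nz zsf conn] := goodR.
have BA0 j k : k != j -> B j i * A i k = 0.
  move=> kj; apply: (@zsf_sum_eq0 _ predT (fun l => B j l * A l k)) => //.
  by rewrite BA eq_sym (negbTE kj).
have [j ABj] : exists j, A i j * B j i <> 0.
  apply: contrapT => /forallNP h; apply: nz.
  have := AB i i; rewrite eqxx big1 // => j _.
  exact: contrapT (h j).
have ABj1 : A i j * B j i = 1.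
  have pair : A i j * B j i + \sum_(k | k != j) A i k * B k i = 1.
    by have := AB i i; rewrite eqxx (bigD1 j).
  have [|//|e0] := conn (A i j * B j i) (\sum_(k | k != j) A i k * B k i).
    split=> //; rewrite mulr_sumr big1 // => k kj.
    by rewrite mulrA -(mulrA _ (B j i)) BA0 // mulr0 mul0r.
  by rewrite -pair e0 addr0.
exists j; split=> // k kj.
(* Multiplying [A i k] by [1 = A i j * B j i] brings in the vanishing product [B j i * A i k]. *)
by rewrite -[LHS]mulr1 -ABj1 mulrCA (mulrC (A i k)) BA0 // mulr0.
Qed.

Lemma invertible_monomial (I J : finType) (A : I -> J -> R) (B : J -> I -> R) :
  (forall i k, \sum_j A i j * B j k = (i == k)%:R) ->
  (forall j l, \sum_i B j i * A i l = (j == l)%:R) ->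
  exists tau : I -> J, [/\ bijective tau,
    forall i j, j != tau i -> A i j = 0 &
    forall i, A i (tau i) * B (tau i) i = 1].
Proof.
move=> AB BA; have [nz _ _] := goodR.
have [tau tauP] := choice (invertible_row AB BA).
have [tau' tau'P] := choice (invertible_row BA AB).
exists tau; split=> [|i j|i]; last 2 first.
- by have [_] := tauP i; apply.
- by have [] := tauP i.
(* The row maps of [A] and [B] are mutually inverse: if [tau' (tau i)] differed from [i], then
   [B (tau i) i] would be 0, although its product with [A i (tau i)] is 1. *)
exists tau' => [i|j]; apply: contrapT => /eqP; rewrite eq_sym => ne; apply: nz.
  have [<- _] := tauP i; have [_ ->] := tau'P (tau i); [exact: mulr0|exact: ne].
have [<- _] := tau'P j; have [_ ->] := tauP (tau' j); [exact: mulr0|exact: ne].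
Qed.

End Monomial.

(** * Sections on affine and irreducible schemes *)

Section Localization.
Variables (R : comPzSemiRingType) (p : spec R).

Lemma localizationP (x : localization p) : exists a s, x = frac a s.
Proof.
elim/semiring_quotW: x => -[a s]; by exists a, s.
Qed.

Lemma frac_eq (a b : R) (s t : set_type (~` p)) :
  frac a s = frac b t :> localization p <->
  exists u : set_type (~` p), val u * (val t * a) = val u * (val s * b).
Proof. exact: semiring_classP. Qed.

Lemma localization0 : (0 : localization p) = frac 0 (den1 p).
Proof. by []. Qed.

Lemma localization1 : (1 : localization p) = frac 1 (den1 p).
Proof. by []. Qed.

Lemma frac_eq0 (a : R) (s : set_type (~` p)) :
  frac a s = 0 :> localization p <->
  exists2 u : R, ~ spec_set p u & u * a = 0.
Proof.
rewrite localization0 frac_eq; split.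
  by move=> [[u up]] /= e; exists u; [exact: set_mem up | rewrite mul1r !mulr0 in e].
by move=> [u up e]; exists (Sub u (mem_set up)); rewrite /= mul1r e !mulr0.
Qed.

Lemma frac_eq1 (a : R) (s : set_type (~` p)) :
  frac a s = 1 :> localization p <->
  exists2 u : R, ~ spec_set p u & u * a = u * val s.
Proof.
rewrite localization1 frac_eq; split.
  by move=> [[u up]] /= e; exists u; [exact: set_mem up | rewrite mul1r mulr1 in e].
by move=> [u up e]; exists (Sub u (mem_set up)); rewrite /= mul1r mulr1.
Qed.

Lemma localization_neq10 : 1 <> 0 :> localization p.
Proof.
rewrite localization1 => /frac_eq0[u up].
rewrite mulr1 => u0; apply: up; rewrite u0.
by have [[]] := spec_prime p.
Qed.

(** Clearing denominators turns a zero sum of fractions into a zero sum in [R]. *)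
Lemma localization_zsf : zero_sum_free R -> zero_sum_free (localization p).
Proof.
move=> zsf x y; have [a [s ->]] := localizationP x; have [b [t ->]] := localizationP y.
rewrite fracD => /frac_eq0[u up]; rewrite mulrDr => /zsf[ea eb].
split; apply/frac_eq0.
  by exists (u * val t); [exact/set_mem/notin_primeM/(valP t)/mem_set | rewrite -mulrA].
by exists (u * val s); [exact/set_mem/notin_primeM/(valP s)/mem_set | rewrite -mulrA].
Qed.

(** A fraction with numerator outside [p] is invertible. Were both numerators in [p], clearing
    denominators in [x + y = 1] would put a product of elements outside [p] into [p]. *)
Lemma localization_unit (x y : localization p) : x + y = 1 ->
  exists z, x * z = 1 \/ y * z = 1.
Proof.
have [a [s ->]] := localizationP x; have [b [t ->]] := localizationP y.
have unit (c : R) (r : set_type (~` p)) : ~ spec_set p c ->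
    exists z : localization p, frac c r * z = 1.
  move=> pc; exists (frac (val r) (Sub c (mem_set pc))).
  rewrite fracM; apply/frac_eq1; exists 1; first exact/set_mem/notin_prime1.
  by rewrite /= !mul1r mulrC.
have [pa|/(unit a s)[z az]] := pselect (spec_set p a); last by exists z; left.
have [pb|/(unit b t)[z bz]] := pselect (spec_set p b); last by exists z; right.
rewrite fracD => /frac_eq1[u up e]; case: (up).
have [[_ pD pM] _ pr] := spec_prime p.
suff : spec_set p (u * (val s * val t)).
  by case/pr=> // /pr[] h; [case: (set_mem (valP s)) | case: (set_mem (valP t))].
by rewrite [val s * val t]/(val (denM s t)) -e; apply/pM/pD; exact: pM.
Qed.

Lemma localization_idempotent_pair (x y : localization p) :
  idempotent_pair x y -> x = 0 \/ y = 0.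
Proof.
move=> [xy0 /localization_unit[z [xz|yz]]].
  by right; rewrite -[y]mulr1 -xz mulrA (mulrC y) xy0 mul0r.
by left; rewrite -[x]mulr1 -yz mulrA xy0 mul0r.
Qed.

End Localization.

(** * Sections over an open subset of an affine scheme *)

Section SpecSections.
Variables (R : comPzSemiRingType) (V : opens (spec R)).

Lemma spec_sec_neq10 (p : spec R) : open_set V p -> 1 <> 0 :> spec_sec V.
Proof.
move=> Vp /(congr1 (fun s : spec_sec V => spec_secval s (Sub p (mem_set Vp)))).
exact: localization_neq10.
Qed.

Lemma spec_sec_zsf : zero_sum_free R -> zero_sum_free (spec_sec V).
Proof.
move=> zsf s t st0.
have stp q : spec_secval s q = 0 /\ spec_secval t q = 0.
  apply: localization_zsf => //.
  exact: (congr1 (fun s : spec_sec V => spec_secval s q) st0).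
by split; apply: spec_secE => q; have [] := stp q.
Qed.

(** Near [p] the section is a single fraction [a / f], and [u * a = 0] for some [u] outside [p]; it
    vanishes at every nearby prime that avoids [u]. *)
Lemma spec_sec_zero_near (s : spec_sec V) (p : set_type V) :
  spec_secval s p = 0 ->
  exists (W : opens (spec R)) (WV : W `<=` V),
    open_set W (val p) /\ spec_res WV s = 0.
Proof.
have [W [WV Wp [a [f sE]]]] := spec_secP s p.
have [pf ->] := sE _ Wp => /frac_eq0[u up ua].
have oD : open ([set q : spec R | ~ spec_set q u]).
  exists [set u]; apply/seteqP; split=> q /=.
    by move=> qu /(_ u); apply: contra_not qu; apply.
  by move=> h; apply: contra_not h => qu _ ->.
have W'V : opensI W (Opens oD) `<=` V by move=> q [/WV].
exists (opensI W (Opens oD)), W'V; split=> //.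
apply: spec_secE => q /=; have [Wq Dq] := set_valP q.
have [qf e] := sE (opens_incl W'V q) Wq.
by rewrite /= e; apply/frac_eq0; exists u.
Qed.

Lemma spec_sec_pair_near (e f : spec_sec V) (p : spec R) :
  open_set V p -> idempotent_pair e f ->
  exists (W : opens (spec R)) (WV : W `<=` V),
    open_set W p /\ (spec_res WV e = 0 \/ spec_res WV f = 0).
Proof.
move=> Vp [ef0 ef1]; pose q : set_type V := Sub p (mem_set Vp).
have [|/(@spec_sec_zero_near _ q)[W [WV [Wp W0]]]|/(@spec_sec_zero_near _ q)[W [WV [Wp W0]]]] :=
  @localization_idempotent_pair _ _ (spec_secval e q) (spec_secval f q).
- split.
    exact: (congr1 (fun s : spec_sec V => spec_secval s q) ef0).
  exact: (congr1 (fun s : spec_sec V => spec_secval s q) ef1).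
- by exists W, WV; split=> //; left.
- by exists W, WV; split=> //; right.
Qed.

End SpecSections.

(** Both [s] and [t] glue the local restrictions of [t], so the uniqueness half of the sheaf axiom
    identifies them. *)
Lemma sheaf_separated (X : topologicalType) (F : opens X -> Type)
    (res : forall U V : opens X, V `<=` U -> F U -> F V) :
  (forall (U V W : opens X) (VU : V `<=` U) (WV : W `<=` V) (WU : W `<=` U) s,
     res _ _ WU s = res _ _ WV (res _ _ VU s)) ->
  is_sheaf res ->
  forall (U : opens X) (s t : F U),
    (forall x, open_set U x -> exists (V : opens X) (VU : V `<=` U),
       open_set V x /\ res _ _ VU s = res _ _ VU t) -> s = t.
Proof.
move=> resc Fsh U s t st.
have /choice[V VP] (x : set_type U) : exists V : opens X, exists VU : V `<=` U,
    open_set V (val x) /\ res _ _ VU s = res _ _ VU t.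
  by have [V [VU h]] := st _ (set_valP x); exists V, VU.
have VU x : V x `<=` U by have [] := VP x.
have stV x : res _ _ (VU x) s = res _ _ (VU x) t.
  by have [VU' [_]] := VP x; rewrite (Prop_irrelevance VU' (VU x)).
have cov : U `<=` \bigcup_x V x.
  by move=> y Uy; exists (Sub y (mem_set Uy)) => //; have [? []] := VP (Sub y (mem_set Uy)).
have [|r [_ rU]] := Fsh _ V U VU cov (fun x => res _ _ (VU x) t).
  move=> x y W Wx Wy.
  by rewrite -!(resc _ _ _ _ _ (subset_trans Wx (VU x))).
by rewrite -(rU s) // (rU t).
Qed.

Section SectionsSeparated.
Variable X : semiringedSpace.

Lemma osec_separated (U : opens X) (s t : osec U) :
  (forall x, open_set U x -> exists (V : opens X) (VU : V `<=` U),
       open_set V x /\ ores VU s = ores VU t) -> s = t.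
Proof. exact: (sheaf_separated (@ores_comp X) (@ores_sheaf X)). Qed.

Lemma msec_separated (F : omodule X) (U : opens X) (s t : msec F U) :
  (forall x, open_set U x -> exists (V : opens X) (VU : V `<=` U),
       open_set V x /\ mres F VU s = mres F VU t) -> s = t.
Proof. exact: (sheaf_separated (@mres_comp X F) (@mres_sheaf X F)). Qed.

End SectionsSeparated.

(** Brings an affine chart inside [W]: algebraic facts about [spec_sec V] pass through [phi], and
    the last clause carries vanishing near [p] over to vanishing near [x]. *)
Lemma affine_sections_near (P : comPzSemiRingType -> Prop) (X : semiringedSpace)
    (W : opens X) (x : X) : locally_spec P X -> open_set W x ->
  exists R : comPzSemiRingType, P R /\
  exists (Z : opens X) (ZW : Z `<=` W) (V : opens (spec R)) (p : spec R)
    (phi : {rmorphism spec_sec V -> osec Z}),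
  [/\ open_set Z x, open_set V p, bijective phi &
    forall (V' : opens (spec R)) (V'V : V' `<=` V), open_set V' p ->
    exists (Z' : opens X) (Z'Z : Z' `<=` Z), open_set Z' x /\
      forall s, spec_res V'V s = 0 -> ores Z'Z (phi s) = 0].
Proof.
move=> locX Wx; have [U [Ux [R [PR [f [g [cf [cg fK gK [phi [phib phiN]]]]]]]]]] := locX x.
exists R; split=> //.
have oW : open ((val : set_type U -> X) @^-1` W) by exists W => //; exact: openP.
(* [V] is the part of [W] inside the chart, read in [Spec R] through the inverse homeomorphism
   [g]. *)
pose V := preim_opens cg (Opens oW : opens (open_sub U)).
pose x' : open_sub U := Sub x (mem_set Ux).
have in_im (V' : opens (spec R)) : open_set V' (f x') -> open_set (sub_image (preim_opens cf V')) x.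
  by move=> V'x; exists x'.
have Vx : open_set V (f x') by rewrite /V /= fK.
have ZW : sub_image (preim_opens cf V) `<=` W.
  by move=> _ [y /= + <-]; rewrite fK.
exists (sub_image (preim_opens cf V)), ZW, V, (f x'), (phi V).
split; [exact: in_im | exact: Vx | exact: phib |].
move=> V' V'V V'x; exists (sub_image (preim_opens cf V')), (sub_imageS (preim_opensS V'V)).
split=> [|s s0]; first exact: in_im.
by have := phiN _ _ V'V s; rewrite /= s0 rmorph0.
Qed.

(** * Sections over nonempty opens of an irreducible scheme *)

Section IrreducibleSections.
Variable X : semiringedSpace.
Hypothesis irrX : irreducible_space X.
Hypothesis locX : locally_spec zero_sum_free X.

Lemma irreducible_meet (U V : opens X) :
  U !=set0 -> V !=set0 -> opensI U V !=set0.
Proof.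
move=> [x Ux] [y Vy]; apply: contrapT => UV0.
have [_ /(_ (~` U) (~` V))] := irrX; case.
- exact/open_closedC/openP.
- exact/open_closedC/openP.
- apply/seteqP; split=> // z _.
  have [Uz|] := pselect (open_set U z); last by left.
  by right=> Vz; apply: UV0; exists z.
- by move=> e; have : (~` U) x by rewrite e.
- by move=> e; have : (~` V) y by rewrite e.
Qed.

Lemma osec_neq10 (W : opens X) : W !=set0 -> 1 <> 0 :> osec W.
Proof.
move=> [x Wx] e10.
have [R [_ [Z [ZW [V [p [phi [Zx Vp phib _]]]]]]]] := affine_sections_near locX Wx.
apply: (@spec_sec_neq10 _ V p Vp); apply: (bij_inj phib).
by rewrite rmorph0 rmorph1 -(rmorph0 (ores ZW)) -e10 rmorph1.
Qed.

Lemma osec_zsf (W : opens X) : zero_sum_free (osec W).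
Proof.
move=> s t st0.
suff res0 x : open_set W x -> exists (V : opens X) (VW : V `<=` W),
    open_set V x /\ (ores VW s = ores VW 0 /\ ores VW t = ores VW 0).
  split; apply: osec_separated => x /res0[V [VW [Vx [? ?]]]]; by exists V, VW.
move=> Wx.
have [R [zsf [Z [ZW [V [p [phi [Zx Vp [psi psiK phiK] _]]]]]]]] := affine_sections_near locX Wx.
exists Z, ZW; split=> //; rewrite rmorph0.
have [] := @spec_sec_zsf R V zsf (psi (ores ZW s)) (psi (ores ZW t)).
  by apply: (can_inj psiK); rewrite rmorphD !phiK -rmorphD st0 !rmorph0.
by move=> /(congr1 phi) + /(congr1 phi); rewrite !phiK rmorph0.
Qed.

Lemma osec_pair (W : opens X) (e f : osec W) :
  idempotent_pair e f -> e = 0 \/ f = 0.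
Proof.
move=> [ef0 ef1].
pose zeros (s : osec W) x := exists (V : opens X) (VW : V `<=` W),
    open_set V x /\ ores VW s = 0.
have sep s : (forall x, open_set W x -> zeros s x) -> s = 0.
  move=> h; apply: osec_separated => x /h[V [VW [Vx V0]]].
  by exists V, VW; rewrite rmorph0.
have cov x : open_set W x -> zeros e x \/ zeros f x.
  move=> Wx.
  have [R [_ [Z [ZW [V [p [phi [Zx Vp [psi psiK phiK] phiN]]]]]]]] := affine_sections_near locX Wx.
  have [|V' [V'V [V'p V'0]]] := @spec_sec_pair_near R V (psi (ores ZW e)) (psi (ores ZW f)) p Vp.
    split; apply: (can_inj psiK).
      by rewrite rmorphM !phiK -rmorphM ef0 !rmorph0.
    by rewrite rmorphD !phiK -rmorphD ef1 !rmorph1.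
  have [Z' [Z'Z [Z'x Z'0]]] := phiN V' V'V V'p.
  have Z'W := subset_trans Z'Z ZW.
  by case: V'0 => /Z'0; rewrite phiK -(ores_comp _ _ Z'W) => h; [left|right]; exists Z', Z'W.
have [|/existsNP[x /not_implyP[Wx ex]]] := pselect (forall x, open_set W x -> zeros e x).
  by left; exact: sep.
(* Now [e] does not vanish near [x], so [f] does. If [e] vanished near some [y], the two
   neighbourhoods would meet in a nonempty open on which [1 = e + f = 0]. *)
right; apply: sep => y /[dup] Wy /cov[[V [VW [Vy V0]]]|//].
have [//|[V' [V'W [V'x V'0]]]] := cov x Wx.
have VV' : opensI V V' !=set0 by apply: irreducible_meet; [exists y | exists x].
case: (osec_neq10 VV').
have TW : opensI V V' `<=` W by move=> z [/VW].
rewrite -(rmorph1 (ores TW)) -ef1 rmorphD.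
rewrite (ores_comp VW opensIl) V0 (ores_comp V'W opensIr) V'0.
by rewrite !rmorph0 addr0.
Qed.

Lemma osec_connected_zero_sum_free (W : opens X) :
  W !=set0 -> connected_zero_sum_free (osec W).
Proof.
by move=> W0; split; [exact: osec_neq10 | exact: osec_zsf | exact: osec_pair].
Qed.

End IrreducibleSections.

(** * Morphisms and frames of modules *)

Section LinearPacking.
Variables (R : pzSemiRingType) (U V : lSemiModType R) (f : U -> V).

Definition linear_of (fl : semilinear f) : {linear U -> V} :=
  HB.pack f (GRing.isSemilinear.Build R U V *:%R f fl).

End LinearPacking.

Section Modules.
Variable X : semiringedSpace.
Implicit Types (F G H : omodule X) (U V W : opens X).

Lemma mresZ F U V (VU : V `<=` U) (a : osec U) (s : msec F U) :
  mres F VU (a *: s) = ores VU a *: mres F VU s.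
Proof. exact: linearZ. Qed.

Lemma mresD F U V (VU : V `<=` U) (s t : msec F U) :
  mres F VU (s + t) = mres F VU s + mres F VU t.
Proof. exact: raddfD. Qed.

Lemma mres_lincomb F U V (VU : V `<=` U) (I : finType) (c : I -> osec U)
    (b : I -> msec F U) :
  mres F VU (\sum_i c i *: b i) = \sum_i ores VU (c i) *: mres F VU (b i).
Proof. by rewrite raddf_sum; apply: eq_bigr => i _; exact: mresZ. Qed.

Lemma lincomb_delta F U (I : finType) (b : I -> msec F U) (k : I) (a : osec U) :
  \sum_l (if l == k then a else 0) *: b l = a *: b k.
Proof.
rewrite (bigD1 k) //= eqxx big1 ?addr0 // => l /negbTE ->.
exact: scale0r.
Qed.

Lemma mres_irr F U V (VU VU' : V `<=` U) (s : msec F U) :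
  mres F VU s = mres F VU' s.
Proof. by rewrite (Prop_irrelevance VU VU'). Qed.

Record omorphism F G := OMorphism {
  mor_fun :> forall U, {linear msec F U -> msec G U};
  mor_nat : forall U V (VU : V `<=` U) (s : msec F U),
    mor_fun V (mres F VU s) = mres G VU (mor_fun U s) }.

Lemma bijective_inj_surj (A B : Type) (f : A -> B) :
  injective f -> (forall y, exists x, f x = y) -> bijective f.
Proof.
move=> fI /choice[g gP]; exists g => // x.
exact/fI/gP.
Qed.

Lemma omodule_iso_sym F G : omodule_iso F G -> omodule_iso G F.
Proof.
move=> [phi [phib phiN]].
have inv U : exists psi : msec G U -> msec F U,
    cancel (phi U) psi /\ cancel psi (phi U).
  by have [psi ? ?] := phib U; exists psi.
pose psi U := sval (cid (inv U)); have psiP U := svalP (cid (inv U)).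
have psi_lin U : semilinear (psi U).
  have [phiK psiK] := psiP U.
  by split=> [a s|s t]; apply: (can_inj phiK); rewrite ?linearZ ?linearD !psiK.
exists (fun U => linear_of (psi_lin U)); split=> [U|U V VU s].
  by have [? ?] := psiP U; exists (phi U).
have [phiK _] := psiP V; have [_ psiK] := psiP U.
by apply: (can_inj phiK) => /=; rewrite phiN psiK (psiP V).2.
Qed.

Lemma omodule_iso_trans F G H :
  omodule_iso F G -> omodule_iso G H -> omodule_iso F H.
Proof.
move=> [phi [phib phiN]] [psi [psib psiN]].
exists (fun U => psi U \o phi U); split=> [U|U V VU s].
  exact: bij_comp (psib U) (phib U).
by rewrite /= phiN psiN.
Qed.

(** Injectivity is local because sections are separated. Local preimages of a section then agree on
    overlaps by injectivity, and glue. *)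
Lemma omorphism_local_iso F G (phi : omorphism F G) :
  (forall x : X, exists U, open_set U x /\
     forall V, V `<=` U -> bijective (phi V)) ->
  omodule_iso F G.
Proof.
move=> phib; exists phi; split; last exact: mor_nat.
have inj W : injective (phi W).
  move=> s t st; apply: msec_separated => x Wx; have [U [Ux Ub]] := phib x.
  exists (opensI W U), opensIl; split=> //.
  by apply: (bij_inj (Ub _ opensIr)); rewrite !mor_nat st.
move=> W; apply: bijective_inj_surj => // t.
have /choice[U UP] : forall x : set_type W, exists U : opens X,
    open_set U (val x) /\ forall V, V `<=` U -> bijective (phi V).
  by move=> x; exact: phib.
have loc (x : set_type W) : {s : msec F (opensI W (U x)) |
    phi _ s = mres G opensIl t}.
  apply: cid; have [g gK Kg] := (UP x).2 (opensI W (U x)) opensIr.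
  by exists (g (mres G opensIl t)).
have [||s [sP _]] := mres_sheaf (U := W) (V := fun x => opensI W (U x)) (o := F)
    (fun x => opensIl) _ (s := fun x => sval (loc x)).
- by move=> y Wy; exists (Sub y (mem_set Wy)) => //; split=> //; case: (UP (Sub y (mem_set Wy))).
- move=> x y Z Zx Zy; apply: inj.
  rewrite !mor_nat (svalP (loc x)) (svalP (loc y)).
  by rewrite -!(mres_comp _ _ (subset_trans Zx opensIl)).
exists s; apply: msec_separated => x Wx.
pose x' : set_type W := Sub x (mem_set Wx).
exists (opensI W (U x')), opensIl; split; first by split=> //; case: (UP x').
by rewrite -mor_nat sP (svalP (loc x')).
Qed.

(** A basis of [F] restricted to [U] as a sheaf: it must remain a basis over every smaller open,
    which does not follow from being a basis over [U] alone. *)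
Definition frame F U (I : finType) (b : I -> msec F U) :=
  forall V (VU : V `<=` U),
    (forall s : msec F V, exists c : I -> osec V,
       s = \sum_i c i *: mres F VU (b i)) /\
    (forall c d : I -> osec V,
       \sum_i c i *: mres F VU (b i) = \sum_i d i *: mres F VU (b i) ->
       forall i, c i = d i).

Lemma frame_span F U (I : finType) (b : I -> msec F U) (s : msec F U) :
  frame b -> exists c : I -> osec U, s = \sum_i c i *: b i.
Proof.
move=> /(_ _ (@subset_refl _ _))[/(_ s)[c ->] _].
by exists c; apply: eq_bigr => i _; rewrite mres_id.
Qed.

Lemma frame_inj F U (I : finType) (b : I -> msec F U) (c d : I -> osec U) :
  frame b -> \sum_i c i *: b i = \sum_i d i *: b i -> forall i, c i = d i.
Proof.
move=> /(_ _ (@subset_refl _ _))[_ /(_ c d) h] e; apply: h.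
have res (a : I -> osec U) :
    \sum_i a i *: mres F (@subset_refl _ U) (b i) = \sum_i a i *: b i.
  by apply: eq_bigr => i _; rewrite mres_id.
by rewrite !res.
Qed.

Lemma frame_res F U V (VU : V `<=` U) (I : finType) (b : I -> msec F U) :
  frame b -> frame (fun i => mres F VU (b i)).
Proof.
move=> bf W WV; have [span inj] := bf W (subset_trans WV VU).
have res (a : I -> osec W) : \sum_i a i *: mres F WV (mres F VU (b i)) =
    \sum_i a i *: mres F (subset_trans WV VU) (b i).
  by apply: eq_bigr => i _; rewrite -(mres_comp _ _ (subset_trans WV VU)).
split=> [s|c d].
  by have [c ->] := span s; exists c; rewrite res.
by rewrite !res; exact: inj.
Qed.

(** A converse to [invertible_monomial]: a monomial change of frame with unit entries is undone by
    [v] and the inverse of [tau]. *)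
Lemma frame_monomial F U (I J : finType) (b : J -> msec F U) (tau : I -> J)
    (u v : I -> osec U) :
  frame b -> bijective tau -> (forall i, u i * v i = 1) ->
  frame (fun i => u i *: b (tau i)).
Proof.
move=> bf [tau' tauK tau'K] uv V VU; have [span inj] := bf V VU.
have res (a : I -> osec V) : \sum_i a i *: mres F VU (u i *: b (tau i)) =
    \sum_j (a (tau' j) * ores VU (u (tau' j))) *: mres F VU (b j).
  rewrite (reindex tau) /=; last by exists tau' => ? _; [exact: tauK|exact: tau'K].
  by apply: eq_bigr => i _; rewrite tauK mresZ scalerA.
split=> [s|c d].
  have [c ->] := span s; exists (fun i => c (tau i) * ores VU (v i)).
  rewrite res; apply: eq_bigr => j _.
  by rewrite tau'K -mulrA (mulrC (ores _ _)) -rmorphM uv rmorph1 mulr1.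
rewrite !res => /inj e i; move: (e (tau i)); rewrite tauK => /(congr1 ( *%R^~ (ores VU (v i)))).
by rewrite -!mulrA -rmorphM uv rmorph1 !mulr1.
Qed.

Lemma frame_reindex F U (I J : finType) (b : J -> msec F U) (tau : I -> J) :
  frame b -> bijective tau -> frame (fun i => b (tau i)).
Proof.
move=> bf taub.
have -> : (fun i => b (tau i)) = (fun i => (fun=> 1 : osec U) i *: b (tau i)).
  by apply/funext => i; rewrite scale1r.
by apply: frame_monomial bf taub _ => i; exact: mulr1.
Qed.

Lemma mor_lincomb F G (phi : omorphism F G) U (I : finType) (c : I -> osec U)
    (b : I -> msec F U) :
  phi U (\sum_i c i *: b i) = \sum_i c i *: phi U (b i).
Proof. by rewrite linear_sum; apply: eq_bigr => i _; rewrite linearZ. Qed.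

Lemma mor_lincomb_res F G (phi : omorphism F G) U V (VU : V `<=` U)
    (I : finType) (c : I -> osec V) (b : I -> msec F U) :
  phi V (\sum_i c i *: mres F VU (b i)) = \sum_i c i *: mres G VU (phi U (b i)).
Proof. by rewrite mor_lincomb; apply: eq_bigr => i _; rewrite mor_nat. Qed.

(** In the coordinates given by the two frames, [phi] is the identity on coefficients. *)
Lemma frame_iso F G (phi : omorphism F G) U (I : finType) (b : I -> msec F U) :
  frame b -> frame (fun i => phi U (b i)) ->
  forall V, V `<=` U -> bijective (phi V).
Proof.
move=> bf phibf V VU; have [span inj] := bf V VU; have [span' inj'] := phibf V VU.
apply: bijective_inj_surj => [s t|t].
  have [c ->] := span s; have [d ->] := span t; rewrite !mor_lincomb_res => /inj' cd.
  by apply: eq_bigr => i _; rewrite cd.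
have [c ->] := span' t; exists (\sum_i c i *: mres F VU (b i)).
exact: mor_lincomb_res.
Qed.

Lemma frame_map F G (phi : omorphism F G) U (I : finType) (b : I -> msec F U) :
  (forall V, V `<=` U -> bijective (phi V)) ->
  frame b -> frame (fun i => phi U (b i)).
Proof.
move=> phib bf V VU; have [span inj] := bf V VU; have [psi phiK psiK] := phib V VU.
split=> [s|c d].
  by have [c e] := span (psi s); exists c; rewrite -mor_lincomb_res -e psiK.
by rewrite -!mor_lincomb_res => /(can_inj phiK)/inj.
Qed.

End Modules.

(** * Direct sums and trivializations *)

Section DirectSumFrames.
Variables (X : semiringedSpace) (I : finType) (L : I -> omodule X).

Lemma dprod_sumE (T : I -> nmodType) (J : finType) (f : J -> Defs.dprod T) i :
  (\sum_j f j) i = \sum_j f j i.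
Proof. exact: (big_morph (fun s : Defs.dprod T => s i)). Qed.

Definition dsum_inj (U : opens X) (i : I) (s : msec (L i) U) : msec (dsum L) U :=
  dfwith (T := fun i => msec (L i) U) (fun=> 0) i s.

Lemma dsum_lincomb (U V : opens X) (VU : V `<=` U) (g : forall i, msec (L i) U)
    (c : I -> osec V) :
  (\sum_i c i *: mres (dsum L) VU (dsum_inj (g i)))
  = (fun i => c i *: mres (L i) VU (g i)) :> dsum_sec L V.
Proof.
apply: functional_extensionality_dep => i; rewrite dprod_sumE (bigD1 i) //= big1.
  by rewrite addr0; congr (c i *: mres (L i) VU _); exact: dfwithin.
move=> j ji; transitivity (c j *: mres (L i) VU 0).
  by congr (_ *: mres (L i) VU _); exact: dfwithout.
by rewrite raddf0 scaler0.
Qed.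

(** A frame indexed by ['I_1] is a single generator; coefficients in the sum are read off one
    component at a time. *)
Lemma dsum_frame (U : opens X) (g : forall i, msec (L i) U) :
  (forall i, frame (fun _ : 'I_1 => g i)) ->
  frame (fun i => dsum_inj (g i)).
Proof.
move=> gf V VU; split=> [s|c d].
  have gen i : exists c : osec V, s i = c *: mres (L i) VU (g i).
    by have [/(_ (s i))[c ->] _] := gf i V VU; exists (c ord0); rewrite big_ord1.
  exists (fun i => sval (cid (gen i))); rewrite dsum_lincomb.
  apply: functional_extensionality_dep => i.
  exact: svalP (cid (gen i)).
rewrite !dsum_lincomb => cd i.
have [_ /(_ (fun=> c i) (fun=> d i)) h] := gf i V VU.
apply: h ord0; rewrite !big_ord1.
exact: (congr1 (fun s : dsum_sec L V => s i) cd).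
Qed.

End DirectSumFrames.

Lemma unit_omodule_frame (X : semiringedSpace) (U : opens X) :
  frame (fun _ : 'I_1 => (1 : osec U) : msec (unit_omodule X) U).
Proof.
move=> V VU.
have res (c : 'I_1 -> osec V) :
    \sum_i c i *: mres (unit_omodule X) VU (1 : osec U) = c ord0.
  by rewrite big_ord1 [mres _ _ _](rmorph1 (ores VU)); exact: mulr1.
split=> [s|c d]; first by exists (fun=> s); rewrite res.
by rewrite !res => e i; rewrite ord1.
Qed.

(** * Trivializations correspond to frames *)

Section Trivializations.
Variable X : semiringedSpace.

(** A trivialization carries the standard basis to a frame; conversely a frame sends a family of
    coefficients to its linear combination. *)
Lemma trivial_on_frame (F : omodule X) (U : opens X) (I : finType) :
  trivial_on F U I <-> exists b : I -> msec F U, frame b.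
Proof.
(* The image in [X] of the whole subspace [U] has the points of [U] but is a different term of
   [opens X], so sections are moved along both inclusions. *)
pose T := sub_image (@opensT (set_type U)).
have TU : T `<=` U by move=> _ [y _ <-]; exact: set_valP.
have UT : U `<=` T by move=> x Ux; exists (Sub x (mem_set Ux)).
pose D := dsum (fun _ : I => unit_omodule (open_sub U)).
(* The standard basis of the free module on [I]. *)
pose e i : msec D opensT :=
  dsum_inj (L := fun _ : I => unit_omodule (open_sub U)) (i := i)
    (1 : osec (opensT : opens (open_sub U))).
have ef : frame e.
  apply: (dsum_frame (L := fun _ : I => unit_omodule (open_sub U))) => i.
  exact: unit_omodule_frame.
split=> [/omodule_iso_sym[psi [psib psiN]]|[b bf]].
  pose m := OMorphism (fun V W => @psiN V W).
  have bf : frame (fun i => m _ (e i)) by apply: frame_map => // V _; exact: psib.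
  exists (fun i => mres F UT (m _ (e i))) => V VU.
  have oV : open ((val : set_type U -> X) @^-1` V) by exists V => //; exact: openP.
  pose V' : opens (open_sub U) := Opens oV.
  have VV' : V `<=` sub_image V'.
    by move=> y Vy; exists (Sub y (mem_set (VU _ Vy))).
  have V'V : sub_image V' `<=` V by move=> _ [y Vy <-].
  have V'T : V' `<=` (opensT : opens (open_sub U)) by [].
  have [span inj] := bf V' V'T.
  split=> [s|c d cd i].
    have [c cE] := span (mres F V'V s).
    exists (fun i => ores VV' (c i)).
    rewrite -[LHS](mres_id (@subset_refl _ V)) (mres_comp V'V VV').
    rewrite cE mres_lincomb; apply: eq_bigr => i _; congr (_ *: _).
    by rewrite -!(mres_comp _ _ (subset_trans VU UT)).
  have res (a : I -> osec V) :
      mres F V'V (\sum_i a i *: mres F VU (mres F UT (m _ (e i)))) =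
      \sum_i ores V'V (a i) *: mres (omodule_sub F U) V'T (m _ (e i)).
    rewrite mres_lincomb; apply: eq_bigr => j _; congr (_ *: _).
    rewrite -(mres_comp _ _ (subset_trans VU UT)).
    by rewrite -(mres_comp _ _ (subset_trans V'V (subset_trans VU UT))); exact: mres_irr.
  have := congr1 (mres F V'V) cd; rewrite !res => /inj/(_ i)/(congr1 (ores VV')).
  by rewrite -!(ores_comp _ _ (@subset_refl _ V)) !ores_id.
have b'f : frame (fun i => mres F TU (b i) : msec (omodule_sub F U) opensT).
  have TbF := frame_res TU bf.
  move=> W WT; have [span inj] := TbF _ (sub_imageS WT).
  by split=> [s|c d]; [exact: span | exact: inj].
apply: omodule_iso_sym.
have toT (W : opens (open_sub U)) : W `<=` (opensT : opens (open_sub U)) by [].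
have lin (W : opens (open_sub U)) : semilinear (fun c : msec D W =>
    \sum_i (c i : osec W) *: mres (omodule_sub F U) (toT W) (mres F TU (b i))
    : msec (omodule_sub F U) W).
  split=> [a c|c d].
    by rewrite scaler_sumr; apply: eq_bigr => i _; rewrite scalerA.
  by rewrite -big_split; apply: eq_bigr => i _; exact: scalerDl.
exists (fun W => linear_of (lin W)); split=> [W|V W WV c] /=.
  have [span inj] := b'f W (toT W).
  apply: bijective_inj_surj => [c d /inj|s].
    by move=> cd; apply: functional_extensionality_dep => i; exact: cd.
  by have [c ->] := span s; exists c.
rewrite (mres_lincomb (F := omodule_sub F U)); apply: eq_bigr => i _; congr (_ *: _).
exact: (mres_comp (o := omodule_sub F U)).
Qed.

End Trivializations.

(** * Comparison of frames, and the rank *)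

Section IrreducibleFrames.
Variable X : semiringedSpace.
Hypothesis irrX : irreducible_space X.
Hypothesis locX : locally_spec zero_sum_free X.

Lemma frame_transition (F : omodule X) (U : opens X) (I J : finType)
    (b : I -> msec F U) (b' : J -> msec F U) :
  U !=set0 -> frame b -> frame b' ->
  exists tau : I -> J, bijective tau /\
  exists u v : I -> osec U,
    forall i, u i * v i = 1 /\ b i = u i *: b' (tau i).
Proof.
move=> U0 bf b'f.
have /choice[A AE] i := frame_span (b i) b'f.
have /choice[B BE] j := frame_span (b' j) bf.
(* Stated for arbitrary families, so that it yields both [AB = 1] and [BA = 1] for the two
   change-of-frame matrices. *)
have mul (K L : finType) (c : K -> msec F U) (d : L -> msec F U) C D :
    frame c -> (forall k, c k = \sum_l C k l *: d l) ->
    (forall l, d l = \sum_k D l k *: c k) ->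
    forall k k', \sum_l C k l * D l k' = (k == k')%:R.
  move=> cf cE dE k; apply: (frame_inj cf); transitivity (c k).
    rewrite cE; under eq_bigr do rewrite scaler_suml.
    rewrite exchange_big; apply: eq_bigr => l _.
    by rewrite dE scaler_sumr; apply: eq_bigr => k' _; rewrite scalerA.
  rewrite (bigD1 k) //= eqxx scale1r big1 ?addr0 // => k' kk'.
  by rewrite eq_sym (negbTE kk') scale0r.
have good := osec_connected_zero_sum_free irrX locX U0.
have [tau [taub A0 Au]] := invertible_monomial good
  (mul _ _ _ _ _ _ bf AE BE) (mul _ _ _ _ _ _ b'f BE AE).
exists tau; split=> //; exists (fun i => A i (tau i)), (fun i => B (tau i) i) => i.
split; first exact: Au.
rewrite [LHS]AE (bigD1 (tau i)) //= big1 ?addr0 // => j /A0 ->.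
exact: scale0r.
Qed.

(** Both frames restrict to the nonempty overlap of [U] and [V], where the transition is a bijection
    of indices. *)
Lemma frame_card (F : omodule X) (U V : opens X) (I J : finType)
    (b : I -> msec F U) (b' : J -> msec F V) :
  U !=set0 -> V !=set0 -> frame b -> frame b' -> #|I| = #|J|.
Proof.
move=> U0 V0 /(frame_res (@opensIl _ U V)) bf /(frame_res (@opensIr _ U V)) b'f.
have [tau [taub _]] := frame_transition (irreducible_meet irrX U0 V0) bf b'f.
exact: bij_eq_card taub.
Qed.

Lemma vector_bundle_of_rankP (F : omodule X) (n : nat) :
  vector_bundle_of_rank F n <->
  forall x : X, exists (U : opens X) (b : 'I_n -> msec F U),
    open_set U x /\ frame b.
Proof.
split=> [[vF rF] x|h].
  have [U [I [Ux tU]]] := vF x; have nI := rF x U I Ux tU.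
  have [b bf] := (trivial_on_frame F U I).1 tU; move: nI => <-.
  exists U, (fun i => b (enum_val i)); split=> //.
  exact: frame_reindex bf (@enum_val_bij I).
split=> [x|x U I Ux /trivial_on_frame[b bf]].
  have [U [b [Ux bf]]] := h x; exists U, 'I_n; split=> //.
  by apply/trivial_on_frame; exists b.
have [V [b' [Vx b'f]]] := h x; rewrite -[RHS]card_ord.
by apply: frame_card bf b'f; exists x.
Qed.

Lemma line_bundleP (L : omodule X) :
  line_bundle L <-> forall x : X, exists (U : opens X) (g : msec L U),
    open_set U x /\ frame (fun _ : 'I_1 => g).
Proof.
rewrite /line_bundle vector_bundle_of_rankP; split=> h x.
  have [U [b [Ux bf]]] := h x; exists U, (b ord0); split=> //.
  by have <- : b = (fun=> b ord0) by apply/funext => i; rewrite ord1.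
by have [U [g [Ux gf]]] := h x; exists U, (fun=> g).
Qed.

End IrreducibleFrames.

(** * Uniqueness of the decomposition *)

Section DirectSumMorphisms.
Variables (X : semiringedSpace) (I : finType) (L : I -> omodule X).

Lemma dsum_inj_semilinear i (U : opens X) : semilinear (@dsum_inj X I L U i).
Proof.
split=> [a s|s t]; apply: functional_extensionality_dep => j.
  change (dsum_inj (a *: s) j = a *: dsum_inj s j).
  rewrite /dsum_inj; have [<-|ij] := eqVneq i j; first by rewrite !dfwithin.
  by rewrite !dfwithout // scaler0.
change (dsum_inj (s + t) j = dsum_inj s j + dsum_inj t j).
rewrite /dsum_inj; have [<-|ij] := eqVneq i j; first by rewrite !dfwithin.
by rewrite !dfwithout // addr0.
Qed.

Lemma dsum_inj_natural i (U V : opens X) (VU : V `<=` U) (s : msec (L i) U) :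
  dsum_inj (mres (L i) VU s) = mres (dsum L) VU (dsum_inj s).
Proof.
apply: functional_extensionality_dep => j.
change (dsum_inj (mres (L i) VU s) j = mres (L j) VU (dsum_inj s j)).
rewrite /dsum_inj; have [<-|ij] := eqVneq i j; first by rewrite !dfwithin.
by rewrite !dfwithout // raddf0.
Qed.

Definition dsum_inj_mor i : omorphism (L i) (dsum L) :=
  @OMorphism X (L i) (dsum L) (fun U => linear_of (@dsum_inj_semilinear i U))
    (@dsum_inj_natural i).

Lemma dsum_proj_semilinear i (U : opens X) :
  semilinear (fun s : msec (dsum L) U => s i).
Proof. by []. Qed.

Definition dsum_proj_mor i : omorphism (dsum L) (L i) :=
  @OMorphism X (dsum L) (L i) (fun U => linear_of (@dsum_proj_semilinear i U))
    (fun _ _ _ _ => erefl).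

End DirectSumMorphisms.

Section MorphismComposition.
Variables (X : semiringedSpace) (F G H : omodule X).

Definition mor_comp (psi : omorphism G H) (phi : omorphism F G) : omorphism F H.
Proof.
exists (fun U => psi U \o phi U) => U V VU s.
by rewrite /= !mor_nat.
Defined.

End MorphismComposition.

Lemma opens_meet (X : topologicalType) (I : finType) (U : I -> opens X) (x : X) :
  (forall i, open_set (U i) x) ->
  exists V : opens X, open_set V x /\ forall i, V `<=` U i.
Proof.
move=> Ux; have : nbhs x [set y | forall i, open_set (U i) y].
  by apply: filter_forall => i; exact: open_nbhs_nbhs (conj (openP (U i)) (Ux i)).
rewrite nbhsE => -[V [oV Vx] VU]; exists (Opens oV); split=> // i y Vy.
exact: VU.
Qed.

Section Uniqueness.
Variable X : semiringedSpace.
Hypothesis irrX : irreducible_space X.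
Hypothesis locX : locally_spec zero_sum_free X.

Lemma common_generators (I : finType) (L : I -> omodule X) (x : X) :
  (forall i, line_bundle (L i)) ->
  exists (U : opens X) (g : forall i, msec (L i) U),
    open_set U x /\ forall i, frame (fun _ : 'I_1 => g i).
Proof.
move=> lineL.
have loc i := (line_bundleP irrX locX (L i)).1 (lineL i) x.
pose U i := sval (cid (loc i)).
pose g i : msec (L i) (U i) := sval (cid (svalP (cid (loc i)))).
have gP i : open_set (U i) x /\ frame (fun _ : 'I_1 => g i).
  exact: svalP (cid (svalP (cid (loc i)))).
have [V [Vx VU]] := opens_meet (fun i => (gP i).1).
exists V, (fun i => mres (L i) (VU i) (g i)); split=> // i.
exact: frame_res (gP i).2.
Qed.

Section Components.
Variables (I : finType) (L L' : I -> omodule X).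
Variable psi : omorphism (dsum L') (dsum L).
Hypothesis psib : forall U, bijective (psi U).

(** The [(i, j)] entry of [psi], seen as a matrix of morphisms between summands. *)
Definition component i j : omorphism (L' i) (L j) :=
  mor_comp (dsum_proj_mor L j) (mor_comp psi (dsum_inj_mor L' i)).

(** The image under [psi] of the frame built from [g'] and the frame built from [g] are two frames
    of [dsum L], so they differ by a permutation and units. *)
Lemma component_transition (U : opens X) (g : forall i, msec (L i) U)
    (g' : forall i, msec (L' i) U) :
  U !=set0 -> (forall i, frame (fun _ : 'I_1 => g i)) ->
  (forall i, frame (fun _ : 'I_1 => g' i)) ->
  exists tau : I -> I, bijective tau /\ exists u v : I -> osec U,
    forall i, [/\ u i * v i = 1, component i (tau i) U (g' i) = u i *: g (tau i) &
      forall j, j != tau i -> component i j U (g' i) = 0].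
Proof.
move=> U0 gf g'f.
have psif := frame_map (phi := psi) (fun V _ => psib V) (dsum_frame g'f).
have [tau [taub [u [v uv]]]] := frame_transition irrX locX U0 psif (dsum_frame gf).
exists tau; split=> //; exists u, v => i; have [uvi e] := uv i.
have comp j : component i j U (g' i) = u i *: dsum_inj (g (tau i)) j.
  exact: (congr1 (fun s : dsum_sec L U => s j) e).
split=> // [|j ji]; rewrite comp; first by rewrite /dsum_inj dfwithin.
by rewrite /dsum_inj dfwithout ?scaler0 // eq_sym.
Qed.

Lemma dsum_iso_perm : (forall i, line_bundle (L i)) ->
  (forall i, line_bundle (L' i)) ->
  exists sigma : {perm I}, forall i, omodule_iso (L' i) (L (sigma i)).
Proof.
move=> lineL lineL'.
have loc x : exists (U : opens X) (g : forall i, msec (L i) U)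
    (g' : forall i, msec (L' i) U), [/\ open_set U x,
    forall i, frame (fun _ : 'I_1 => g i) & forall i, frame (fun _ : 'I_1 => g' i)].
  have [U [g [Ux gf]]] := common_generators x lineL.
  have [U' [g' [U'x g'f]]] := common_generators x lineL'.
  exists (opensI U U'), (fun i => mres (L i) opensIl (g i)),
    (fun i => mres (L' i) opensIr (g' i)).
  by split=> // i; exact: frame_res.
have [[x0 _] _] := irrX.
have [U [g [g' [Ux gf g'f]]]] := loc x0.
have U0 : U !=set0 by exists x0.
have [tau [taub [u [v tauP]]]] := component_transition U0 gf g'f.
exists (perm (bij_inj taub)) => i; rewrite permE.
apply: (omorphism_local_iso (phi := component i (tau i))) => x.
have [V [h [h' [Vx hf h'f]]]] := loc x.
have V0 : V !=set0 by exists x.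
have [rho [rhob [w [z rhoP]]]] := component_transition V0 hf h'f.
exists V; split=> //.
(* Otherwise the component at [(i, tau i)] kills the generator [h' i], hence kills [g' i] on the
   overlap of [V] and [U]. There it also sends [g' i] to [u i] times a generator, so the unit [u i]
   would be 0. *)
have rho_tau : rho i = tau i.
  apply: contrapT => /eqP; rewrite eq_sym => ne.
  have W0 := irreducible_meet irrX V0 U0.
  have [_ _ /(_ _ ne) comp0] := rhoP i; have [uv compu _] := tauP i.
  have [span _] := h'f i _ (@opensIl _ V U).
  have [c cE] := span (mres (L' i) (@opensIr _ V U) (g' i)).
  have := mor_nat (component i (tau i)) (@opensIr _ V U) (g' i).
  rewrite cE mor_lincomb_res big_ord1 comp0 raddf0 scaler0 compu mresZ.
  have [_ inj] := gf (tau i) _ (@opensIr _ V U).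
  have := inj (fun=> 0) (fun=> ores (@opensIr _ V U) (u i)).
  rewrite !big_ord1 scale0r => h0 {}/h0 h0; have u0 := h0 ord0.
  apply: (osec_neq10 locX W0).
  by rewrite -(rmorph1 (ores (@opensIr _ V U))) -uv rmorphM -u0 mul0r.
(* Over [V] the component sends one generator to a unit multiple of another, which is again a
   generator. *)
have [wz compw _] := rhoP i; rewrite -rho_tau.
apply: frame_iso (h'f i) _; rewrite compw.
have idb : bijective (@id 'I_1) by exists id.
exact: frame_monomial (hf (rho i)) idb (fun=> wz).
Qed.

End Components.
End Uniqueness.

(** * Existence of the decomposition *)

Section SubModules.
Variables (X : semiringedSpace) (F : omodule X).
Variable P : forall U : opens X, set (msec F U).
Hypothesis P0 : forall U, P (0 : msec F U).
Hypothesis PD : forall U (s t : msec F U), P s -> P t -> P (s + t).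
Hypothesis PZ : forall U (a : osec U) (s : msec F U), P s -> P (a *: s).
Hypothesis Pres : forall (U V : opens X) (VU : V `<=` U) (s : msec F U),
  P s -> P (mres F VU s).
Hypothesis Ploc : forall U (s : msec F U),
  (forall x, open_set U x -> exists (V : opens X) (VU : V `<=` U),
     open_set V x /\ P (mres F VU s)) -> P s.

Definition sub_pred U : {pred msec F U} := fun s => `[< P s >].

Fact sub_pred_closed U : subsemimod_closed (@sub_pred U).
Proof.
split; first split.
- exact/asboolP/P0.
- by move=> s t /asboolP Ps /asboolP Pt; exact/asboolP/PD.
- by move=> a s /asboolP Ps; exact/asboolP/PZ.
Qed.

Record sub_sec (U : opens X) := SubSec {
  sub_secval :> msec F U;
  _ : sub_secval \in @sub_pred U }.

HB.instance Definition _ U := [isSub for @sub_secval U].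
HB.instance Definition _ U := [Choice of sub_sec U by <:].
HB.instance Definition _ U := GRing.SubChoice_isSubLSemiModule.Build
  (osec U) (msec F U) (@sub_pred U) (sub_sec U) (@sub_pred_closed U).

Lemma sub_secP U (s : sub_sec U) : P (sub_secval s).
Proof. exact/asboolP/(valP s). Qed.

Definition sub_of U (s : msec F U) (Ps : P s) : sub_sec U :=
  SubSec (introT (asboolP (P s)) Ps).

Section Restriction.
Variables (U V : opens X) (VU : V `<=` U).

Definition sub_res (s : sub_sec U) : sub_sec V :=
  sub_of (Pres VU (sub_secP s)).

Fact sub_res_semilinear : semilinear_for (ores VU \; *:%R) sub_res.
Proof.
by split=> [a s|s t]; apply: val_inj; [exact: mresZ | exact: raddfD].
Qed.

HB.instance Definition _ :=
  GRing.isSemilinear.Build _ _ _ (ores VU \; *:%R) sub_res sub_res_semilinear.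
End Restriction.

Fact sub_res_id (U : opens X) (UU : U `<=` U) (s : sub_sec U) :
  sub_res UU s = s.
Proof. by apply: val_inj; exact: mres_id. Qed.

Fact sub_res_comp (U V W : opens X) (VU : V `<=` U) (WV : W `<=` V)
  (WU : W `<=` U) (s : sub_sec U) : sub_res WU s = sub_res WV (sub_res VU s).
Proof. by apply: val_inj; exact: mres_comp. Qed.

Fact sub_sheaf : is_sheaf (fun U V (VU : V `<=` U) => sub_res VU).
Proof.
move=> I V U VU Ucov s agree.
have [i j W Wi Wj|t [tE tU]] := mres_sheaf VU Ucov (s := fun i => sub_secval (s i)).
  exact: (congr1 (@sub_secval W) (agree i j W Wi Wj)).
(* Gluing takes place in [F]; locality of [P] puts the result in the subsheaf. *)
have Pt : P t.
  apply: Ploc => x /Ucov[i _ Vx]; exists (V i), (VU i); split=> //.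
  by rewrite tE; exact: sub_secP.
exists (sub_of Pt); split=> [i|t' t'E]; apply: val_inj; first exact: tE.
by apply: tU => i; exact: (congr1 (@sub_secval _) (t'E i)).
Qed.

Definition sub_omodule : omodule X :=
  @OModule X sub_sec (fun U V VU => sub_res VU)
    sub_res_id sub_res_comp sub_sheaf.

End SubModules.

(** * The lines determined by a reference frame *)

Section Lines.
Variables (X : semiringedSpace) (n : nat) (F : omodule X).
Hypothesis irrX : irreducible_space X.
Hypothesis locX : locally_spec zero_sum_free X.
Hypothesis frameF : forall x : X, exists (U : opens X) (b : 'I_n -> msec F U),
  open_set U x /\ frame b.

Variables (U0 : opens X) (b0 : 'I_n -> msec F U0).
Hypotheses (U0_neq0 : U0 !=set0) (b0_frame : frame b0).

(** A section over [V] is compared with [b0 i] on the overlap with [U0], which is nonempty as soon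
    as [V] is. *)
Definition along (i : 'I_n) (V : opens X) (s : msec F V) :=
  exists a : osec (opensI V U0), mres F opensIl s = a *: mres F opensIr (b0 i).

Lemma along_scale i V (a : osec V) (s : msec F V) :
  along i s -> along i (a *: s).
Proof.
move=> [c e]; exists (ores opensIl a * c).
by rewrite mresZ e scalerA.
Qed.

Lemma along_res i (V W : opens X) (WV : W `<=` V) (s : msec F V) :
  along i s -> along i (mres F WV s).
Proof.
move=> [c e]; have WVU : opensI W U0 `<=` opensI V U0.
  by move=> x [/WV].
exists (ores WVU c).
rewrite -(mres_comp _ _ (subset_trans WVU opensIl)) (mres_comp opensIl WVU) e.
by rewrite mresZ -(mres_comp opensIr WVU opensIr).
Qed.

Lemma along_frame (V : opens X) (b : 'I_n -> msec F V) :
  V !=set0 -> frame b ->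
  exists tau : 'I_n -> 'I_n, bijective tau /\
    forall i j, along i (b j) <-> i = tau j.
Proof.
move=> V0 bf; have W0 := irreducible_meet irrX V0 U0_neq0.
have [tau [taub [u [v uv]]]] := frame_transition irrX locX W0
  (frame_res (@opensIl _ V U0) bf) (frame_res (@opensIr _ V U0) b0_frame).
exists tau; split=> // i j; have [uvj bj] := uv j.
split=> [[a]|->]; last by exists (u j).
(* If [b j] were also a multiple of [b0 i] with [i] other than [tau j], comparing coefficients at
   [tau j] would give [u j = 0]. *)
rewrite bj => e; apply: contrapT => /eqP ij.
move: e; rewrite -!(lincomb_delta (fun l => mres F opensIr (b0 l))).
move=> /(frame_inj (frame_res (@opensIr _ V U0) b0_frame))/(_ (tau j)).
rewrite eqxx eq_sym (negbTE ij) => u0.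
by apply: (osec_neq10 locX W0); rewrite -uvj u0 mul0r.
Qed.

(** A member of a frame runs along exactly one [b0 i], both before and after restriction, and
    restriction preserves that index. *)
Lemma along_res_frame (V W : opens X) (WV : W `<=` V) (b : 'I_n -> msec F V) i j :
  W !=set0 -> frame b -> along i (mres F WV (b j)) <-> along i (b j).
Proof.
move=> W0 bf; split; last exact: along_res.
have V0 : V !=set0 by case: W0 => x /WV; exists x.
have [tau [_ tauP]] := along_frame V0 bf.
have [rho [_ rhoP]] := along_frame W0 (frame_res WV bf).
have /(along_res WV)/rhoP e : along (tau j) (b j) by apply/tauP.
by move=> /rhoP; rewrite -e => /tauP.
Qed.

(* Quantifying over all frames is needed: restriction to [U0] need not be
   injective, so being [along] [b0 i] on [U0] would be too weak a condition on a
   section over [W]. *)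
Definition in_line (i : 'I_n) (W : opens X) : set (msec F W) := fun s =>
  forall (V : opens X) (VW : V `<=` W) (b : 'I_n -> msec F V) (c : 'I_n -> osec V),
    V !=set0 -> frame b -> mres F VW s = \sum_j c j *: b j ->
    forall j, ~ along i (b j) -> c j = 0.

Lemma in_line0 i W : in_line i (0 : msec F W).
Proof.
move=> V VW b c V0 bf; rewrite raddf0 => e j _.
apply: (frame_inj bf (c := c) (d := fun=> 0)); rewrite -e big1 // => k _.
exact: scale0r.
Qed.

Lemma in_lineD i W (s t : msec F W) :
  in_line i s -> in_line i t -> in_line i (s + t).
Proof.
move=> si ti V VW b c V0 bf; rewrite mresD.
have [d dE] := frame_span (mres F VW s) bf; have [e eE] := frame_span (mres F VW t) bf.
rewrite dE eE -big_split => E j nj.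
rewrite -[c j](frame_inj bf (c := fun j => d j + e j)).
  by rewrite (si _ _ _ _ V0 bf dE) // (ti _ _ _ _ V0 bf eE) // addr0.
by rewrite -E; apply: eq_bigr => k _; exact: scalerDl.
Qed.

Lemma in_lineZ i W (a : osec W) (s : msec F W) : in_line i s -> in_line i (a *: s).
Proof.
move=> si V VW b c V0 bf; rewrite mresZ.
have [d dE] := frame_span (mres F VW s) bf.
rewrite dE scaler_sumr => E j nj.
rewrite -[c j](frame_inj bf (c := fun j => ores VW a * d j)).
  by rewrite (si _ _ _ _ V0 bf dE) // mulr0.
by rewrite -E; apply: eq_bigr => k _; rewrite scalerA.
Qed.

Lemma in_line_res i (U W : opens X) (WU : W `<=` U) (s : msec F U) :
  in_line i s -> in_line i (mres F WU s).
Proof.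
move=> si V VW b c V0 bf; rewrite -(mres_comp _ _ (subset_trans VW WU)).
exact: si.
Qed.

(** Vanishing of a coefficient is local, and by [along_res_frame] restricting a frame does not
    change which members run along [b0 i]. *)
Lemma in_line_local i (U : opens X) (s : msec F U) :
  (forall x, open_set U x -> exists (V : opens X) (VU : V `<=` U),
     open_set V x /\ in_line i (mres F VU s)) -> in_line i s.
Proof.
move=> h V VU b c V0 bf e j nj; apply: osec_separated => x Vx.
have [Z [ZU [Zx sZ]]] := h x (VU _ Vx).
exists (opensI V Z), opensIl; split=> //.
have W0 : opensI V Z !=set0 by exists x.
rewrite rmorph0.
apply: (sZ _ opensIr _ (fun j => ores opensIl (c j)) W0 (frame_res (@opensIl _ V Z) bf)).
  rewrite -mres_lincomb -e -(mres_comp _ _ (subset_trans opensIl VU)).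
  by rewrite -(mres_comp _ _ (subset_trans opensIl VU)).
by rewrite (along_res_frame opensIl i j W0 bf).
Qed.

Definition line (i : 'I_n) : omodule X :=
  sub_omodule (@in_line0 i) (@in_lineD i) (@in_lineZ i) (@in_line_res i)
    (@in_line_local i).

Lemma in_line_frame (V : opens X) (b : 'I_n -> msec F V) i j :
  V !=set0 -> frame b -> along i (b j) -> in_line i (b j).
Proof.
move=> V0 bf ij W WV b' c W0 b'f e k nk.
have [tau [_ [u [v /(_ j)[uv bj]]]]] :=
  frame_transition irrX locX W0 (frame_res WV bf) b'f.
(* In the frame [b'] the section [b j] has its only nonzero coefficient at [tau j], and [b' (tau j)]
   is a multiple of [b j], so it runs along [b0 i], unlike [b' k]. *)
have kj : k != tau j.
  apply: contra_notN nk => /eqP ->.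
  have -> : b' (tau j) = v j *: mres F WV (b j).
    by rewrite bj scalerA mulrC uv scale1r.
  exact/along_scale/along_res.
rewrite -[c k](frame_inj b'f (c := fun l => if l == tau j then u j else 0)).
  by rewrite (negbTE kj).
by rewrite lincomb_delta -bj.
Qed.

(** The other members of [b] do not run along [b0 i], so a section of the line has zero coefficients
    there and is a multiple of [b j]. *)
Lemma line_frame (V : opens X) (b : 'I_n -> msec F V) i j (h : in_line i (b j)) :
  V !=set0 -> frame b -> along i (b j) ->
  (forall k, k != j -> ~ along i (b k)) ->
  frame (fun _ : 'I_1 => sub_of h : msec (line i) V).
Proof.
move=> V0 bf ij nik W WV; have [span inj] := bf W WV.
have res (c : 'I_1 -> osec W) : sub_secval
    (\sum_l c l *: mres (line i) WV (sub_of h) : sub_sec (@in_line i) W)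
    = c ord0 *: mres F WV (b j) by rewrite big_ord1.
split=> [s|c d e l].
  have [c cE] := span (sub_secval s); exists (fun=> c j); apply: val_inj.
  rewrite [RHS]res [LHS]cE (bigD1 j) //= big1 ?addr0 // => k kj.
  suff -> : c k = 0 by exact: scale0r.
  apply: osec_separated => x Wx; exists W, (@subset_refl _ _); split=> //.
  have W0 : W !=set0 by exists x.
  congr (ores _ _).
  apply: (sub_secP s _ (@subset_refl _ W) _ c W0 (frame_res WV bf)).
    by rewrite mres_id.
  by rewrite (along_res_frame WV i k W0 bf); exact: nik.
have := congr1 (@sub_secval _ _ _ W) e; rewrite !res ord1.
rewrite -!(lincomb_delta (fun l => mres F WV (b l))) => /inj/(_ j).
by rewrite eqxx.
Qed.

Lemma line_frames (x : X) : exists (V : opens X) (b : 'I_n -> msec F V)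
    (tau : 'I_n -> 'I_n) (g : forall i, msec (line i) V),
  [/\ open_set V x, frame b, bijective tau,
    forall i, frame (fun _ : 'I_1 => g i) &
    forall i, sub_secval (g i) = b (tau i)].
Proof.
have [V [b [Vx bf]]] := frameF x; have V0 : V !=set0 by exists x.
have [tau [[tau' tauK tau'K] tauP]] := along_frame V0 bf.
(* [tau] sends a member of the frame to its line; the inverse [tau'] picks the member that will
   generate line [i]. *)
have bi i : along i (b (tau' i)) by apply/tauP; rewrite tau'K.
pose h i := in_line_frame V0 bf (bi i).
exists V, b, tau', (fun i => sub_of (h i)); split=> //.
  by exists tau.
move=> i; apply: line_frame => // k ki /tauP ik.
by move: ki; rewrite ik tauK eqxx.
Qed.

Lemma line_line_bundle i : line_bundle (line i).
Proof.
apply/(line_bundleP irrX locX) => x.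
have [V [b [tau [g [Vx _ _ gf _]]]]] := line_frames x.
by exists V, (g i).
Qed.

Definition line_sum (U : opens X) (s : msec (dsum line) U) : msec F U :=
  \sum_i sub_secval (s i : sub_sec (@in_line i) U).

Fact line_sum_semilinear U : semilinear (@line_sum U).
Proof.
split=> [a s|s t]; rewrite /line_sum.
  by rewrite scaler_sumr.
by rewrite -big_split.
Qed.

Fact line_sum_natural (U V : opens X) (VU : V `<=` U) (s : msec (dsum line) U) :
  line_sum (mres (dsum line) VU s) = mres F VU (line_sum s).
Proof. by rewrite raddf_sum. Qed.

Lemma dsum_line_iso : omodule_iso F (dsum line).
Proof.
apply: omodule_iso_sym.
pose phi := @OMorphism X (dsum line) F
  (fun U => linear_of (@line_sum_semilinear U)) line_sum_natural.
apply: (omorphism_local_iso (phi := phi)) => x.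
have [V [b [tau [g [Vx bf taub gf gE]]]]] := line_frames x.
exists V; split=> //; apply: frame_iso (dsum_frame gf) _.
(* Summation takes the generators of the lines to a reordering of the frame [b], hence a frame to a
   frame. *)
have -> : (fun i => phi V (dsum_inj (g i))) = (fun i => b (tau i)).
  apply/funext => i; rewrite -gE /= /line_sum (bigD1 i) //= big1.
    by rewrite addr0 /dsum_inj dfwithin.
  by move=> j ji; rewrite /dsum_inj dfwithout // eq_sym.
exact: frame_reindex bf taub.
Qed.

End Lines.


Theorem theoremA (X : semiringedSpace) (n : nat) (F : omodule X)
    (hX : semiring_scheme X)
    (irrX : irreducible_space X)
    (locX : locally_spec
       (fun R => zero_sum_free R /\ only_trivial_idempotent_pairs R) X)
    (hF : vector_bundle_of_rank F n) :
  (exists L : 'I_n -> omodule X,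
     (forall i, line_bundle (L i)) /\ omodule_iso F (dsum L)) /\
  (forall L L' : 'I_n -> omodule X,
     (forall i, line_bundle (L i)) -> omodule_iso F (dsum L) ->
     (forall i, line_bundle (L' i)) -> omodule_iso F (dsum L') ->
     exists sigma : 'S_n, forall i, omodule_iso (L' i) (L (sigma i))).
Proof.
have zsfX : locally_spec zero_sum_free X.
  by move=> x; have [U [Ux [R [[zsf _] UR]]]] := locX x; exists U; split=> //; exists R.
split.
  have frameF := (vector_bundle_of_rankP irrX zsfX F n).1 hF.
  (* An irreducible space has a point; a frame near it serves as the reference frame for the
     lines. *)
  have [[x0 _] _] := irrX; have [U0 [b0 [U0x b0f]]] := frameF x0.
  have U00 : U0 !=set0 by exists x0.
  exists (line irrX zsfX U00 b0f); split=> [i|].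
    exact: line_line_bundle.
  exact: dsum_line_iso.
move=> L L' lineL FL lineL' FL'.
(* Passing through [F] gives an isomorphism from [dsum L'] to [dsum L]. *)
have [psi [psib psiN]] := omodule_iso_trans (omodule_iso_sym FL') FL.
exact: (dsum_iso_perm irrX zsfX (psi := OMorphism psiN) psib lineL lineL').
Qed.
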